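(* Assume that $g\in L^\infty(I;\mathbb R)$ and $|\{x\in I:g(x)\ne0\}|>0$. Then the pair $(A_{\rm cr},B_{\rm cr})$ is controllable. Consequently, there exists $K_{\rm cr}\in\mathcal L(X_{\rm cr},X)$ such that $A_{\rm cr}+B_{\rm cr}K_{\rm cr}$ is Hurwitz. In particular, there exist $M_{\rm cr}\ge1$ and $\omega_{\rm cr}>0$ such that $$\left\|e^{(A_{\rm cr}+B_{\rm cr}K_{\rm cr})t}\right\|_{\mathcal L(X_{\rm cr})}\le M_{\rm cr}e^{-\omega_{\rm cr}t},\qquad t\ge0.$$
   Context: Let $\ell>0$, $I=(0,\ell)$, $X=L^2(I)$, $\epsilon_1>0$, $\bar\alpha_1\in L^\infty(I;\mathbb R)$. On $X$ let $A_n\phi=\epsilon_1\phi_{xx}+\bar\alpha_1\phi$ with $D(A_n)=H^2(I)\cap H_0^1(I)$ (self-adjoint, bounded above, with compact resolvent), and let $B\in\mathcal L(X)$ be the multiplication operator $(B\psi)(x)=g(x)\psi(x)$. Fix $\rho>0$. $P_{\rm cr}$ denotes the orthogonal spectral projection of $A_n$ associated with the eigenvalues contained in $(-\rho,\infty)$; $X_{\rm cr}=P_{\rm cr}X$ (finite-dimensional), $A_{\rm cr}=A_n|_{X_{\rm cr}}$, and $B_{\rm cr}=P_{\rm cr}B\in\mathcal L(X,X_{\rm cr})$. Controllability is that of the system $\dot q=A_{\rm cr}q+B_{\rm cr}U$ with finite-dimensional state space $X_{\rm cr}$ and input space $X$. Hurwitz means that all eigenvalues have negative real part. *)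

(* Defs.v *)
From HB Require Import structures.
From mathcomp Require Import all_boot all_order all_algebra ring_quotient.
From mathcomp Require Import all_classical all_reals all_analysis.
From mathcomp Require Import measurable_realfun.

Set Implicit Arguments.
Unset Strict Implicit.
Unset Printing Implicit Defensive.
Import Order.TTheory GRing.Theory Num.Theory.
Import numFieldNormedType.Exports.

Local Open Scope classical_set_scope.
Local Open Scope ring_scope.
Local Open Scope quotient_scope.

Section L2_space.
Context {d} {T : measurableType d} {R : realType}.
Variable mu : {measure set T -> \bar R}.

Notation Lf := (LfunType mu (lee1n 2)).

Definition L2null : {pred Lf} :=
  [pred f : Lf | `[< {ae mu, forall x, f x = 0} >]].

Lemma L2nullP (f : Lf) : reflect {ae mu, forall x, f x = 0} (f \in L2null).
Proof. exact: asboolP. Qed.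

Lemma L2null_zmod_closed : zmod_closed L2null.
Proof.
split; first by apply/L2nullP; apply: nearW.
move=> f g /L2nullP f0 /L2nullP g0; apply/L2nullP.
apply: filterS2 f0 g0 => x f0 g0.
by rewrite -[LHS]/(f x - g x) f0 g0 subr0.
Qed.

HB.instance Definition _ :=
  GRing.isZmodClosed.Build Lf L2null L2null_zmod_closed.

(* Real L^2(mu).  The library's [LspaceType2] carries no vector space structure;
   quotienting by the null functions makes L^2(mu) a normed module. *)
Definition L2 : Type := {ideal_quot L2null}.
HB.instance Definition _ := GRing.Zmodule.on L2.
HB.instance Definition _ := EqQuotient.on L2.

Lemma eqL2P (f g : Lf) : \pi_L2 f = \pi_L2 g <-> {ae mu, forall x, f x = g x}.
Proof.
split=> [/eqmodP/L2nullP|fg].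
  by apply: filterS => x fg; apply/eqP; rewrite -subr_eq0; apply/eqP.
apply/eqmodP/L2nullP; apply: filterS fg => x fg.
by rewrite -[LHS]/(f x - g x) fg subrr.
Qed.

Lemma repr_piL2 (f : Lf) : {ae mu, forall x, repr (\pi_L2 f) x = f x}.
Proof. by apply/eqL2P; rewrite reprK. Qed.

Definition L2_scale (a : R) (f : L2) : L2 := \pi_L2 (a *: repr f).

Lemma piL2Z a (f : Lf) : \pi_L2 (a *: f) = L2_scale a (\pi_L2 f).
Proof.
apply/eqL2P; have := repr_piL2 f; apply: filterS => x fx.
by rewrite -[LHS]/(a * f x) -[RHS]/(a * repr (\pi_L2 f) x) fx.
Qed.

Lemma piL2D (f g : Lf) : \pi_L2 (f + g) = \pi_L2 f + \pi_L2 g.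
Proof. exact: (@Quotient.pi_add _ L2null f g). Qed.

Lemma piL20 : \pi_L2 (0 : Lf) = 0.
Proof. by apply: (@addrI _ (\pi_L2 0)); rewrite -piL2D addr0 [RHS]addr0. Qed.

Lemma L2_scaleA a b f : L2_scale a (L2_scale b f) = L2_scale (a * b) f.
Proof. by rewrite -[f]reprK -(piL2Z b) -!piL2Z scalerA. Qed.
Lemma L2_scale1 : left_id 1 L2_scale.
Proof. by move=> f; rewrite -[f]reprK -piL2Z scale1r. Qed.
Lemma L2_scaleDr : right_distributive L2_scale +%R.
Proof.
by move=> a f g; rewrite -[f]reprK -[g]reprK -piL2D -!piL2Z scalerDr piL2D.
Qed.
Lemma L2_scaleDl f : {morph L2_scale^~ f : a b / a + b}.
Proof. by move=> a b; rewrite -[f]reprK -!piL2Z scalerDl piL2D. Qed.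

HB.instance Definition _ := GRing.Zmodule_isLmodule.Build R L2
  L2_scaleA L2_scale1 L2_scaleDr L2_scaleDl.

Definition L2_norm (f : L2) : R := fine ('N[mu]_2%:E[EFin \o (repr f : T -> R)])%E.

Lemma L2_norm_pi (f : Lf) :
  L2_norm (\pi_L2 f) = fine ('N[mu]_2%:E[EFin \o f])%E.
Proof.
have mn (h : Lf) :
    measurable_fun [set: T] (fun x => `|(h x)%:E| `^ 2 : \bar R)%E.
  apply: (measurableT_comp (measurable_poweR _)).
  by apply: measurableT_comp => //; exact/measurable_EFinP.
congr fine; rewrite unlock /Lnorm; congr (_ `^ _)%E.
apply: ae_eq_integral; [by []|exact: mn|exact: mn|].
by have := repr_piL2 f; apply: filterS => x fx xT; rewrite /= fx.
Qed.

Lemma L2_normD (f g : L2) : L2_norm (f + g) <= L2_norm f + L2_norm g.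
Proof.
by rewrite -[f]reprK -[g]reprK -piL2D !L2_norm_pi; exact: ler_LnormD.
Qed.

Lemma L2_normZ a (f : L2) : L2_norm (a *: f) = `|a| * L2_norm f.
Proof.
rewrite -[f]reprK -[_ *: _]piL2Z !L2_norm_pi LnormZ.
by rewrite -finite_norm_fine.
Qed.

Lemma L2_norm0_eq0 (f : L2) : L2_norm f = 0 -> f = 0.
Proof.
rewrite -[f]reprK L2_norm_pi => /fine_Lnormr_eq0 f0.
by rewrite -piL20; apply/eqL2P; apply: filterS f0 => x /(_ I).
Qed.

HB.instance Definition _ := Lmodule_isNormed.Build R L2
  L2_normD L2_normZ L2_norm0_eq0.

End L2_space.

Definition L2_fun d (T : measurableType d) (R : realType)
  (mu : {measure set T -> \bar R}) (f : L2 mu) : T -> R := repr f.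
Coercion L2_fun : L2 >-> Funclass.

(* The class in L^2(mu) of a square-integrable function (0 for a function that is
   a.e. equal to no element of L^2(mu)). *)
Definition L2_class d (T : measurableType d) (R : realType)
    (mu : {measure set T -> \bar R}) (f : T -> R) : L2 mu :=
  xget 0 [set h : L2 mu | {ae mu, forall x, h x = f x}].

Lemma L2_classE d (T : measurableType d) (R : realType)
    (mu : {measure set T -> \bar R}) (f : T -> R) : f \in Lfun mu 2%:E ->
  {ae mu, forall x, L2_class mu f x = f x}.
Proof.
move=> fL; rewrite /L2_class; case: xgetP => [h _ //|noh].
by case: (noh (\pi_(L2 mu) (Lfun_Sub (lee1n 2) fL))); exact: repr_piL2.
Qed.

Definition L2_inner d (T : measurableType d) (R : realType)
    (mu : {measure set T -> \bar R}) (f h : L2 mu) : R :=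
  \int[mu]_x (f x * h x).

Section span.
Context {R : realType} {V : normedModType R}.
Variable G : set V.

Definition lspan : {pred V} := [pred v : V |
  `[< exists (n : nat) (c : 'I_n -> R) (e : 'I_n -> V),
        (forall i, G (e i)) /\ v = \sum_(i < n) c i *: e i >]].

Lemma lspan_submod_closed : submod_closed lspan.
Proof.
split.
  apply/asboolP; exists 0%N, (fun=> 0), (fun=> 0).
  by split=> [[]//|]; rewrite big_ord0.
move=> a u v /asboolP[n [c [e [Ge ->]]]] /asboolP[m [c' [e' [Ge' ->]]]].
apply/asboolP; exists (n + m)%N.
exists (fun i => match fintype.split i with inl j => a * c j | inr j => c' j end).
exists (fun i => match fintype.split i with inl j => e j | inr j => e' j end).
split=> [i|]; first by case: (fintype.split i).
rewrite big_split_ord scaler_sumr; congr (_ + _); apply: eq_bigr => i _.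
- by rewrite (unsplitK (inl _ i)) scalerA.
- by rewrite (unsplitK (inr _ i)).
Qed.

HB.instance Definition _ :=
  GRing.isSubmodClosed.Build R V lspan lspan_submod_closed.

Record spanType := SpanType { span_val :> V; span_valP : span_val \in lspan }.

HB.instance Definition _ := [isSub for span_val].
HB.instance Definition _ := [Choice of spanType by <:].
HB.instance Definition _ := [SubChoice_isSubLmodule of spanType by <:].

Definition span_norm (v : spanType) : R := `|span_val v|.

Lemma span_normD (u v : spanType) :
  span_norm (u + v) <= span_norm u + span_norm v.
Proof. exact: ler_normD. Qed.
Lemma span_normZ a (v : spanType) : span_norm (a *: v) = `|a| * span_norm v.
Proof. exact: normrZ. Qed.
Lemma span_norm0_eq0 (v : spanType) : span_norm v = 0 -> v = 0.
Proof. by move=> /normr0_eq0 v0; apply: val_inj. Qed.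

HB.instance Definition _ := Lmodule_isNormed.Build R spanType
  span_normD span_normZ span_norm0_eq0.

End span.

Section linear_systems.
Context {R : realType}.

(* Controllability of q' = A q + B U: any state can be steered to any other
   state in any positive time, by a continuous input and along a classical
   trajectory. *)
Definition controllable (V W : normedModType R)
    (A : V -> V) (B : W -> V) : Prop :=
  forall (t1 : R) (q0 q1 : V), 0 < t1 ->
  exists (U : R -> W) (q : R -> V),
    [/\ {within `[0, t1], continuous U},
        {within `[0, t1], continuous q},
        forall t, 0 < t < t1 -> is_derive t 1 q (A (q t) + B (U t)),
        q 0 = q0 & q t1 = q1].

(* The real and imaginary parts of [S (u + iv) = (a + ib) (u + iv)], with
   [u + iv != 0], for the complexification of the real operator [S]. *)
Definition complex_eigenvalue (V : normedModType R)
    (S : V -> V) (a b : R) : Prop :=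
  exists u v : V, [/\ u != 0 \/ v != 0,
    S u = a *: u - b *: v & S v = b *: u + a *: v].

Definition hurwitz (V : normedModType R) (S : V -> V) : Prop :=
  forall a b : R, complex_eigenvalue S a b -> a < 0.

(* [e^{tS} v], as the norm limit of the exponential series. *)
Definition exp_op (V : normedModType R) (S : V -> V) (t : R) (v : V) : V :=
  limn (series (fun k => (t ^+ k / k`!%:R) *: iter k S v)).

Definition op_norm (V W : normedModType R) (S : V -> W) : \bar R :=
  ereal_sup [set `|S v|%:E | v in [set v : V | `|v| <= 1]].

End linear_systems.

Section dirichlet.
Context {R : realType}.
Variable l : R.

Definition Iset : set R := `]0, l[%classic.

Lemma measurable_Iset : measurable (Iset : set (measurableTypeR R)).
Proof. exact: measurable_itv. Qed.

(* Lebesgue measure on the interval I, as a measure on R carried by I. *)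
Definition leb_I : {measure set (measurableTypeR R) -> \bar R} :=
  mrestr (@lebesgue_measure R) measurable_Iset.

Local Notation X := (L2 leb_I).

(* C^1 functions with compact support in I; as usual in dimension one, they serve
   both to define weak derivatives and, by closure, H^1_0(I). *)
Definition test_fun (phi : R -> R) : Prop :=
  [/\ forall x, derivable phi x 1, continuous (derive1 phi) &
      exists a b : R, [/\ 0 < a, b < l & forall x, x \notin `[a, b] -> phi x = 0]].

Definition weak_deriv (u v : X) : Prop :=
  forall phi, test_fun phi ->
    \int[leb_I]_x (u x * derive1 phi x) = - \int[leb_I]_x (v x * phi x).

Definition H1 : set X := [set u | exists v, weak_deriv u v].

(* The weak derivative of an element of H^1(I), and 0 outside H^1(I). *)
Definition Dx (u : X) : X := xget 0 [set v | weak_deriv u v].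

Definition H2 : set X := [set u | H1 u /\ H1 (Dx u)].

(* The closure of the test functions for the norm of H^1(I). *)
Definition H10 : set X := [set u | H1 u /\ forall e : R, 0 < e ->
  exists2 phi, test_fun phi &
    `|u - L2_class leb_I phi| < e /\ `|Dx u - L2_class leb_I (derive1 phi)| < e].

Definition mulop (g : R -> R) (u : X) : X :=
  L2_class leb_I (fun x => g x * u x).

Variables (eps1 : R) (alpha1 : R -> R).

Definition D_An : set X := H2 `&` H10.

Definition An (phi : X) : X := eps1 *: Dx (Dx phi) + mulop alpha1 phi.

Definition eigenvector_An (lambda : R) (phi : X) : Prop :=
  [/\ D_An phi, phi != 0 & An phi = lambda *: phi].

Variable rho : R.

(* The sum of the eigenspaces of [An] for the eigenvalues in (-rho, +oo), that is
   the range of the corresponding spectral projection: there are finitely many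
   such eigenvalues, of finite multiplicity, so no closure is needed. *)
Definition Xcr := spanType
  [set phi : X | exists2 lambda, - rho < lambda & eigenvector_An lambda phi].
HB.instance Definition _ := NormedModule.on Xcr.

(* The orthogonal projection onto [Xcr]; it exists and is unique because [Xcr] is
   finite-dimensional, so the default value 0 is never taken. *)
Definition Pcr (f : X) : Xcr := xget 0
  [set p : Xcr | forall y : Xcr, L2_inner (f - span_val p) (span_val y) = 0].

(* The restriction of [An] to [Xcr], which [An] maps to itself: the default
   value 0 of [insubd] is never taken. *)
Definition Acr (q : Xcr) : Xcr := insubd (0 : Xcr) (An (span_val q)).

Definition Bcr (g : R -> R) (u : X) : Xcr := Pcr (mulop g u).

End dirichlet.

Arguments Xcr {R} l eps1 alpha1 rho.
Arguments Pcr {R l eps1 alpha1 rho} f.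
Arguments Acr {R} l eps1 alpha1 rho q.
Arguments Bcr {R} l eps1 alpha1 rho g u.

(* Main.v *)
Require Import Defs.
From HB Require Import structures.
From mathcomp Require Import all_boot all_order all_algebra ring_quotient.
From mathcomp Require Import all_classical all_reals all_analysis.
From mathcomp Require Import measurable_realfun ess_sup_inf.
From mathcomp Require Import ring lra.
Set Implicit Arguments.
Unset Strict Implicit.
Unset Printing Implicit Defensive.
Import Order.TTheory GRing.Theory Num.Theory.
Import numFieldNormedType.Exports.
Local Open Scope classical_set_scope.
Local Open Scope ring_scope.

(** The operator [B_cr] is onto, so that a right inverse [S] of it gives both
    claims: steer along the segment [q] from [q0] to [q1] with the input
    [U = S (q' - A_cr q)], and put [K = S (- id - A_cr)], for which
    [A_cr + B_cr K = - id].

    Ontoness amounts to the injectivity of [q |-> g q] on [X_cr], which makes the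
    Gram matrix [<g e_i, g e_j>] of a basis invertible.  If [g q = 0], then [q]
    vanishes on a set [E] of positive measure.  A function which vanishes on [E]
    has zero weak derivative a.e. on [E], hence [q''] and [A_n q] vanish on [E]
    too.  Writing [q] as a sum of eigenfunctions, [(A_n - lambda) q] is a shorter
    sum for a suitable [lambda], hence zero by induction, so that [q] is itself an
    eigenfunction; as [q] and [q'] have a common zero, Gronwall's inequality
    gives [q = 0].

    [X_cr] has finite dimension because [|q'| <= C |q|] on it: if the continuous
    representative of [q] vanishes at the points [j l / N], [j < N], with [N] large,
    then [|q|^2 <= (l^2 / N) |q'|^2] forces [q = 0]. *)

(** * The inner product of L^2 *)

Section L2_inner_product.
Context {d} {T : measurableType d} {R : realType}.
Variable mu : {measure set T -> \bar R}.
Local Notation X := (L2 mu).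

Lemma ae_eq_Rintegral (F G : T -> R) : measurable_fun setT F ->
  measurable_fun setT G -> {ae mu, forall x, F x = G x} ->
  \int[mu]_x F x = \int[mu]_x G x.
Proof.
move=> mF mG FG; congr fine; apply: ae_eq_integral => //.
- exact/measurable_EFinP.
- exact/measurable_EFinP.
- by apply: filterS FG => x /= ->.
Qed.

Lemma L2_fun_Lfun (f : X) : (f : T -> R) \in Lfun mu 2%:E.
Proof. exact: (@LfunP _ _ _ mu _ (lee1n 2)). Qed.

Lemma Lfun_measurable (p : \bar R) (F : T -> R) : F \in Lfun mu p ->
  measurable_fun setT F.
Proof. by move=> /andP[+ _]; rewrite inE. Qed.

Lemma L2_measurable (f : X) : measurable_fun setT (f : T -> R).
Proof. exact: Lfun_measurable (L2_fun_Lfun f). Qed.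
Hint Resolve L2_measurable : core.

Lemma L2_fun_pi (g : X) (F : LfunType mu (lee1n 2)) : g = \pi_X%qT F ->
  {ae mu, forall x, g x = F x}.
Proof. by move=> ->; exact: repr_piL2. Qed.

Lemma L2_funD (f h : X) : {ae mu, forall x, (f + h : X) x = f x + h x}.
Proof.
by apply: (@L2_fun_pi _ (repr f + repr h)); rewrite piL2D !reprK.
Qed.

Lemma L2_funZ a (f : X) : {ae mu, forall x, (a *: f : X) x = a * f x}.
Proof. exact: repr_piL2. Qed.

Lemma L2_fun0 : {ae mu, forall x, (0 : X) x = 0}.
Proof. by apply: (@L2_fun_pi _ 0); rewrite piL20. Qed.

Lemma eqL2 (f h : X) : {ae mu, forall x, f x = h x} -> f = h.
Proof. by move=> fh; rewrite -[f]reprK -[h]reprK; apply/eqL2P. Qed.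

Lemma L2_integrableM (f h : X) :
  mu.-integrable setT (EFin \o (fun x => f x * h x)).
Proof.
by apply/Lfun1_integrable; exact: Lfun2_mul_Lfun1 (L2_fun_Lfun f) (L2_fun_Lfun h).
Qed.
Hint Resolve L2_integrableM : core.

Lemma L2_innerC (f h : X) : L2_inner f h = L2_inner h f.
Proof. by apply: eq_Rintegral => x _; rewrite mulrC. Qed.

Lemma L2_innerDl (f1 f2 h : X) :
  L2_inner (f1 + f2) h = L2_inner f1 h + L2_inner f2 h.
Proof.
rewrite /L2_inner -RintegralD//; apply: ae_eq_Rintegral.
- exact: measurable_funM.
- by apply: measurable_funD; exact: measurable_funM.
- by apply: filterS (L2_funD f1 f2) => x ->; rewrite mulrDl.
Qed.

Lemma L2_innerZl a (f h : X) : L2_inner (a *: f) h = a * L2_inner f h.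
Proof.
rewrite /L2_inner -RintegralZl//; apply: ae_eq_Rintegral.
- exact: measurable_funM.
- by apply: measurable_funM => //; exact: measurable_funM.
- by apply: filterS (L2_funZ a f) => x ->; rewrite mulrA.
Qed.

Lemma L2_innerDr (f h1 h2 : X) :
  L2_inner f (h1 + h2) = L2_inner f h1 + L2_inner f h2.
Proof. by rewrite L2_innerC L2_innerDl !(L2_innerC _ f). Qed.

Lemma L2_innerZr a (f h : X) : L2_inner f (a *: h) = a * L2_inner f h.
Proof. by rewrite L2_innerC L2_innerZl (L2_innerC _ f). Qed.

Lemma L2_innerNl (f h : X) : L2_inner (- f) h = - L2_inner f h.
Proof. by rewrite -scaleN1r L2_innerZl mulN1r. Qed.

Lemma L2_innerNr (f h : X) : L2_inner f (- h) = - L2_inner f h.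
Proof. by rewrite L2_innerC L2_innerNl L2_innerC. Qed.

Lemma L2_innerBl (f1 f2 h : X) :
  L2_inner (f1 - f2) h = L2_inner f1 h - L2_inner f2 h.
Proof. by rewrite L2_innerDl L2_innerNl. Qed.

Lemma L2_innerBr (f h1 h2 : X) :
  L2_inner f (h1 - h2) = L2_inner f h1 - L2_inner f h2.
Proof. by rewrite L2_innerDr L2_innerNr. Qed.

Lemma L2_inner0l (h : X) : L2_inner 0 h = 0.
Proof. by rewrite -(scale0r h) L2_innerZl mul0r. Qed.

Lemma L2_inner0r (h : X) : L2_inner h 0 = 0.
Proof. by rewrite L2_innerC L2_inner0l. Qed.

Lemma L2_inner_suml I (r : seq I) (P : pred I) (F : I -> X) (h : X) :
  L2_inner (\sum_(i <- r | P i) F i) h = \sum_(i <- r | P i) L2_inner (F i) h.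
Proof.
by apply: (big_morph (fun f => L2_inner f h)) => [f1 f2|]; [exact: L2_innerDl|exact: L2_inner0l].
Qed.

Lemma L2_inner_sumr I (r : seq I) (P : pred I) (F : I -> X) (h : X) :
  L2_inner h (\sum_(i <- r | P i) F i) = \sum_(i <- r | P i) L2_inner h (F i).
Proof. by rewrite L2_innerC L2_inner_suml; apply: eq_bigr => i _; rewrite L2_innerC. Qed.

Lemma L2_inner_self (f : X) : L2_inner f f = `|f| ^+ 2.
Proof.
have fin := L2_fun_Lfun f; have ge0 : (0 <= 'N[mu]_2%:E [EFin \o f])%E by exact: Lnorm_ge0.
rewrite /L2_inner -[`|f|]/(L2_norm f) /L2_norm -/(L2_fun f).
have -> : fine 'N[mu]_2%:E [EFin \o f] ^+ 2 = fine ('N[mu]_2%:E [EFin \o f] `^ 2)%E.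
  by rewrite fine_poweR powR_mulrn// fine_ge0.
rewrite powR_Lnorm//; congr fine; apply: eq_integral => x _.
by rewrite /= powR_mulrn// -normrX ger0_norm ?sqr_ge0// expr2.
Qed.

Lemma L2_inner_self_eq0 (f : X) : L2_inner f f = 0 -> f = 0.
Proof. by rewrite L2_inner_self => /eqP; rewrite sqrf_eq0 => /eqP /normr0_eq0. Qed.

Lemma L2_cauchy_schwarz (f h : X) : `|L2_inner f h| <= `|f| * `|h|.
Proof.
have [->|h0] := eqVneq h 0; first by rewrite L2_inner0r normr0 normr0 mulr0.
have hp : 0 < `|h| ^+ 2 by rewrite exprn_gt0// normr_gt0.
rewrite -(@ler_pXn2r _ 2)// ?nnegrE ?mulr_ge0// exprMn -normrX ger0_norm ?sqr_ge0//.
(* The residual of the orthogonal projection of [f] onto the line of [h] has squared norm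
   [|f|^2 - <f, h>^2 / |h|^2]. *)
have := sqr_ge0 `|f - (L2_inner f h / `|h| ^+ 2) *: h|.
rewrite -(L2_inner_self (f - _)) L2_innerBl !L2_innerBr !L2_innerZl !L2_innerZr.
rewrite !L2_inner_self (L2_innerC h f) => H.
have : 0 <= `|h| ^+ 2 * (`|f| ^+ 2 - L2_inner f h ^+ 2 / `|h| ^+ 2).
  rewrite pmulr_rge0//; apply: le_trans H _.
  by rewrite le_eqVlt; apply/orP; left; apply/eqP; field; rewrite normr_eq0.
suff -> : `|h| ^+ 2 * (`|f| ^+ 2 - L2_inner f h ^+ 2 / `|h| ^+ 2) =
    `|f| ^+ 2 * `|h| ^+ 2 - L2_inner f h ^+ 2 by rewrite subr_ge0.
by field; rewrite normr_eq0.
Qed.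

(** Brings integrals against a concrete function, such as a test function, under bilinearity and
    Cauchy-Schwarz. *)
Lemma L2_inner_class (f : X) (F : T -> R) : F \in Lfun mu 2%:E ->
  L2_inner f (L2_class mu F) = \int[mu]_x (f x * F x).
Proof.
move=> FL; apply: ae_eq_Rintegral.
- exact: measurable_funM.
- by apply: measurable_funM => //; exact: Lfun_measurable FL.
- by apply: filterS (L2_classE FL) => x ->.
Qed.

End L2_inner_product.
#[local] Hint Resolve L2_measurable L2_integrableM : core.

(** * Primitives on (0, l) *)

Section leb_I.
Context {R : realType}.
Variable l : R.
Local Notation mu := (@lebesgue_measure R).
Local Notation nu := (leb_I l).
Local Notation I := (Iset l).
Local Notation X := (L2 nu).

#[global] Instance ae_leb_I_filter : Filter (nbhs (almost_everywhere nu)) :=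
  ae_filter_ringOfSetsType nu.

Lemma leb_I_le (A : set (measurableTypeR R)) : measurable A -> (nu A <= mu A)%E.
Proof.
move=> mA; rewrite /leb_I/= /mrestr le_measure ?inE//.
by apply: measurableI => //; exact: measurable_Iset.
Qed.

Lemma leb_I_setT_fin : nu setT \is a fin_num.
Proof.
rewrite /leb_I/= /mrestr setTI ge0_fin_numE// /Iset lebesgue_measure_itv/=.
by case: ifP => _; rewrite ?ltry// EFinN sub0e ltry.
Qed.

Lemma leb_I_notI : nu (~` I) = 0%E.
Proof. by rewrite /leb_I/= /mrestr setICl measure0. Qed.

Lemma ae_leb_I (P : R -> Prop) :
  {ae nu, forall x, P x} <-> {ae mu, forall x, I x -> P x}.
Proof.
split=> -[A [mA A0 PA]].
  exists (A `&` I); split=> //; first by apply: measurableI => //; exact: measurable_Iset.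
  move=> x /= /not_implyP[Ix nPx].
  by split=> //; apply: PA.
exists (A `|` ~` I); split.
- by apply: measurableU => //; apply: measurableC; exact: measurable_Iset.
- apply/eqP; rewrite eq_le measure_ge0 andbT.
  rewrite /leb_I/= /mrestr setIUl setICl setU0 -A0 le_measure ?inE//.
  by apply: measurableI => //; exact: measurable_Iset.
- move=> x /= nP; have [Ix|nIx] := pselect (I x); [left|by right].
  by apply: PA => /= H; apply: nP; exact: H.
Qed.

Lemma ae_in_I : {ae nu, forall x, I x}.
Proof. by apply/ae_leb_I; exact: nearW. Qed.

(** The part of [D] outside [I] is negligible, and both measures agree on subsets of [I]. This gives
    access to the fundamental theorem of calculus for Lebesgue measure. *)
Lemma integral_leb_I (D : set (measurableTypeR R)) (f : R -> \bar R) :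
  measurable D -> nu.-integrable setT f ->
  (\int[nu]_(x in D) f x = \int[mu]_(x in D) (f \_ I) x)%E.
Proof.
move=> mD fi.
have mI := measurable_Iset l.
rewrite integral_mkcond (@negligible_integral _ (measurableTypeR R) R nu setT (~` I))//; first last.
- exact: leb_I_notI.
- refine (iffLR (@integrable_mkcond _ (measurableTypeR R) R nu D f mD) _).
  by apply: integrableS fi.
- exact: measurableC.
rewrite setDE setCK setTI (@eq_measure_integral _ _ _ _ mu); last first.
  by move=> A mA AI; rewrite /leb_I/= /mrestr; congr (mu _); apply/setIidPl.
rewrite integral_mkcond [RHS]integral_mkcond; apply: eq_integral => x _.
by rewrite !patchE; case: ifP => //; case: ifP.
Qed.

Lemma integrable_leb_I (f : R -> \bar R) : nu.-integrable setT f ->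
  mu.-integrable I f.
Proof.
move=> /integrableP[mf fi]; apply/integrableP; split.
  exact: measurable_funTS.
apply: le_lt_trans fi.
rewrite (@eq_measure_integral _ (measurableTypeR R) R I nu mu); last first.
  by move=> A mA AI; rewrite /leb_I/= /mrestr (setIidl AI).
apply: ge0_subset_integral => //.
- exact: measurable_Iset.
- exact: measurableT_comp.
Qed.

(** The measure charges only [I], so for [x] in [I] this is the integral from 0 to [x]; starting at
    -oo defines it on the whole line. *)
Definition prim (f : R -> R) (x : R) := \int[nu]_(t in `]-oo, x]) f t.

Lemma primE (f : R -> R) : nu.-integrable setT (EFin \o f) ->
  prim f = fun x => \int[mu]_(t in `]-oo, x]) (f \_ I) t.
Proof.
move=> fi; apply/funext => x; rewrite /prim /Rintegral; congr fine.
rewrite (@integral_leb_I _ (EFin \o f))//.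
by rewrite restrict_EFin.
Qed.

Lemma integrable_restrict_I (f : R -> R) : nu.-integrable setT (EFin \o f) ->
  mu.-integrable setT (EFin \o (f \_ I)).
Proof.
move=> fi; rewrite -restrict_EFin.
exact: (iffLR (@integrable_mkcond _ (measurableTypeR R) R mu I (EFin \o f)
  (measurable_Iset l)) (integrable_leb_I fi)).
Qed.

(** Lebesgue's differentiation theorem, for [f] extended by 0 outside [I]. *)
Lemma prim_derive_ae (f : R -> R) : nu.-integrable setT (EFin \o f) ->
  {ae nu, forall x : R, is_derive x 1 (prim f) (f x)}.
Proof.
move=> fi; apply/ae_leb_I; have fI := integrable_restrict_I fi.
have := @FTC1Ny R (f \_ I); rewrite -primE// => H.
have : {ae mu, forall x, derivable (prim f) x 1 /\ derive1 (prim f) x = (f \_ I) x}.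
  apply: H.
  - by move=> y; apply: integrableS fI.
  - apply: integrable_locally; first exact: measurable_Iset.
    exact: integrable_leb_I.
apply: filterS; first exact: (ae_filter_ringOfSetsType mu).
move=> x [dx dxE] Ix; split=> //.
by rewrite -derive1E dxE patchE mem_set.
Qed.

Lemma prim_derive (f : R -> R) (x : R) : nu.-integrable setT (EFin \o f) ->
  {for x, continuous f} -> I x -> is_derive x 1 (prim f) (f x).
Proof.
move=> fi fc Ix; have fI := integrable_restrict_I fi.
have := @continuous_FTC1 R (f \_ I) -oo%O x (x + 1); rewrite -primE// => -[||||dx dxE].
- by rewrite ltrDl.
- by apply: integrableS fI.
- by rewrite ltNyr.
- have IN : \forall y \near x, I y by apply: open_nbhs_nbhs; split => //; exact: itv_open.
  rewrite /prop_for /continuous_at patchE mem_set//.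
  apply: cvg_trans fc; apply: near_eq_cvg.
  by apply: filterS IN => y Iy; rewrite patchE mem_set.
- by split=> //; rewrite -derive1E dxE patchE mem_set.
Qed.

End leb_I.

(** * Pairing with bounded functions and dominated convergence *)

Section bounded.
Context {R : realType}.
Variable l : R.
Local Notation nu := (leb_I l).
Local Notation X := (L2 nu).
Local Notation measI F := (measurable_fun (setT : set (measurableTypeR R)) F).

Lemma Lfun_bounded (F : R -> R) (M : R) : measI F ->
  (forall x, `|F x| <= M) -> F \in Lfun nu 2%:E.
Proof.
move=> mF FM; rewrite inE; apply/andP; split; rewrite inE//=.
rewrite /finite_norm unlock /Lnorm poweR_lty//.
apply: (@le_lt_trans _ _ (\int[nu]_x (M `^ 2)%:E)%E); last first.
  by rewrite integral_cst// ltey_eq fin_numM// leb_I_setT_fin.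
apply: ge0_le_integral => //.
- by move=> x _; rewrite /= lee_fin powR_ge0.
- apply/measurable_EFinP.
  apply: (@measurableT_comp _ _ _ _ _ _ (@powR R ^~ 2)) => //.
  exact: measurableT_comp.
- by move=> x _; rewrite /= lee_fin ge0_ler_powR// nnegrE (le_trans _ (FM x)).
Qed.

Lemma L2_integrable (f : X) : nu.-integrable setT (EFin \o f).
Proof.
by apply/Lfun1_integrable; apply: (Lfun_subset12 (leb_I_setT_fin l)); exact: L2_fun_Lfun.
Qed.

Lemma L2_integrableM_bounded (f : X) (F : R -> R) (M : R) : measI F ->
  (forall x, `|F x| <= M) -> nu.-integrable setT (EFin \o (fun x => f x * F x)).
Proof.
move=> mF FM; apply/Lfun1_integrable.
by apply: Lfun2_mul_Lfun1; [exact: L2_fun_Lfun|exact: Lfun_bounded FM].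
Qed.

(** Dominated convergence; the dominating function [|f M|] is integrable because [leb_I] is
    finite. *)
Lemma cvg_L2_bounded (f : X) (F : nat -> R -> R) (G : R -> R) (M : R) :
  (forall n, measI (F n)) -> (forall n x, `|F n x| <= M) ->
  (forall x, F ^~ x @ \oo --> G x) ->
  (\int[nu]_x (f x * F n x)) @[n --> \oo] --> \int[nu]_x (f x * G x).
Proof.
move=> mF FM FG.
have mG : measI G.
  by apply: (measurable_fun_cvg mF) => x _; exact: FG.
have [|||||iG _ H] := @dominated_convergence _ _ _ nu setT measurableT
  (fun n x => (f x * F n x)%:E) (fun x => (f x * G x)%:E) (fun x => `|f x * M|%:E).
- by move=> n; apply/measurable_EFinP; exact: measurable_funM.
- by apply/measurable_EFinP; exact: measurable_funM.
- apply: nearW => x _; apply/fine_cvgP; split; first by apply: nearW.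
  by apply: cvgM; [exact: cvg_cst|exact: FG].
- apply: (integrable_norm (f := fun x => f x * M)).
  exact: (@L2_integrableM_bounded f (cst M) `|M|).
- apply: nearW => x n _.
  by rewrite /= lee_fin !normrM ler_wpM2l// (le_trans (FM n x))// ler_norm.
apply: (@fine_cvg _ _ _ _ _ _ ) => //.
rewrite /Rintegral fineK//; exact: integrable_fin_num.
Qed.

End bounded.

(** * Weak derivatives *)

Section ramp.
Context {R : realType}.
Implicit Types (x y d : R).

Definition pos_part x : R := Num.max 0 x.

(** A quadratic Taylor remainder, valid also across the kink at 0; by [is_derive_error] the square
    of the positive part is differentiable everywhere. *)
Lemma pos_part_sqr_error x y :
  `|pos_part y ^+ 2 - pos_part x ^+ 2 - 2 * pos_part x * (y - x)| <= (y - x) ^+ 2.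
Proof.
have Q := sqr_ge0 (y - x); rewrite /pos_part ler_norml;
  case: (lerP 0 x) => hx; case: (lerP 0 y) => hy.
- by apply/andP; split; nra.
- by have := mulr_ge0_le0 hx (ltW hy); move=> P; apply/andP; split; nra.
- by have := mulr_le0_ge0 (ltW hx) hy; move=> P; apply/andP; split; nra.
- by apply/andP; split; nra.
Qed.

Lemma is_derive_error (f : R -> R) x a (C : R) :
  (forall y, `|f y - f x - a * (y - x)| <= C * (y - x) ^+ 2) ->
  is_derive x 1 f a.
Proof.
move=> H.
suff cv : h^-1 *: (f (h + x) - f x) @[h --> 0^'] --> a.
  split; last by apply/cvg_lim => //; rewrite /= in cv *; under eq_fun do rewrite [_ *: 1]mulr1.
  by apply/cvg_ex; exists a; rewrite /= in cv *; under eq_fun do rewrite [_ *: 1]mulr1.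
have Cn : `|C| * `|h| @[h --> (0 : R)^'] --> 0.
  rewrite -[X in _ --> X](mulr0 `|C|) -[in X in _ --> X](normr0 R).
  apply: cvgM; first exact: cvg_cst.
  by apply: cvg_norm; apply: cvg_within_filter; exact: cvg_id.
apply/subr_cvg0; apply: norm_cvg0; apply: squeeze_cvgr (cvg_cst 0) Cn.
near=> h; have h0 : h != 0 by near: h; exact: nbhs_dnbhs_neq.
rewrite normr_ge0/=.
have -> : h^-1 *: (f (h + x) - f x) - a = h^-1 * (f (h + x) - f x - a * h).
  by rewrite /GRing.scale/=; field.
rewrite normrM normfV ler_pdivrMl ?normr_gt0//.
have := H (h + x); rewrite addrK => /le_trans; apply.
rewrite [X in _ <= X]mulrCA -expr2 -normrX (ger0_norm (sqr_ge0 h)).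
by rewrite ler_wpM2r ?sqr_ge0// ler_norm.
Unshelve. all: by end_near. Qed.

Lemma pos_part_continuous : continuous pos_part.
Proof.
move=> x; apply: (@continuous_max _ _ (cst 0) id); [exact: cvg_cst|exact: cvg_id].
Qed.

(** For [d > 0], the continuous piecewise linear function equal to 0 up to 0, of slope [1 / d] on
    [[0, d]], and equal to 1 beyond. *)
Definition step d x : R := (pos_part x - pos_part (x - d)) / d.
(* A C^1 approximation of the positive part; its derivative [step d] approximates
   the Heaviside function. *)
Definition ramp d x : R := (pos_part x ^+ 2 - pos_part (x - d) ^+ 2) / (2 * d).

Lemma is_derive_ramp d x : 0 < d -> is_derive x 1 (ramp d) (step d x).
Proof.
(* Each of the two squares has an error of at most [(y - x)^2], before the division by [2 * d]. *)
move=> d0; apply: (@is_derive_error _ _ _ (2 / (2 * d))) => y.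
have := pos_part_sqr_error x y; have := pos_part_sqr_error (x - d) (y - d).
rewrite /ramp /step.
have -> : y - d - (x - d) = y - x by ring.
move=> E1 E2.
have -> : (pos_part y ^+ 2 - pos_part (y - d) ^+ 2) / (2 * d) -
  (pos_part x ^+ 2 - pos_part (x - d) ^+ 2) / (2 * d) -
  (pos_part x - pos_part (x - d)) / d * (y - x) =
  ((pos_part y ^+ 2 - pos_part x ^+ 2 - 2 * pos_part x * (y - x)) -
  (pos_part (y - d) ^+ 2 - pos_part (x - d) ^+ 2 - 2 * pos_part (x - d) * (y - x)))
   / (2 * d).
  by field; rewrite gt_eqF.
have d20 : 0 < 2 * d by rewrite mulr_gt0.
rewrite normrM normfV (gtr0_norm d20).
rewrite [X in _ <= X]mulrAC ler_pM2r ?invr_gt0//.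
by apply: le_trans (ler_normB _ _) _; lra.
Qed.

Lemma step_continuous d : continuous (step d).
Proof.
move=> x; apply: cvgM; last exact: cvg_cst.
apply: cvgB; first exact: pos_part_continuous.
apply: (@continuous_comp _ _ _ (fun y => y - d) pos_part);
  last exact: pos_part_continuous.
by apply: cvgB; [exact: cvg_id|exact: cvg_cst].
Qed.

Lemma step_bound d x : 0 < d -> 0 <= step d x <= 1.
Proof.
move=> d0; rewrite /step ler_pdivlMr// ler_pdivrMr// mul0r mul1r /pos_part.
by case: (lerP 0 x) => hx; case: (lerP 0 (x - d)) => hy; apply/andP; split; lra.
Qed.

Lemma ramp_bound d x : 0 < d -> pos_part x - d <= ramp d x <= pos_part x.
Proof.
move=> d0; rewrite /ramp ler_pdivlMr ?mulr_gt0// ler_pdivrMr ?mulr_gt0// /pos_part.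
by case: (lerP 0 x) => hx; case: (lerP 0 (x - d)) => hy; apply/andP; split; nra.
Qed.

Lemma ramp_ge0 d x : 0 < d -> 0 <= ramp d x.
Proof.
move=> d0; rewrite /ramp divr_ge0 ?mulr_ge0 ?(ltW d0)//.
have p0 y : 0 <= pos_part y by rewrite /pos_part le_max lexx.
rewrite subr_ge0 ler_sqr ?nnegrE// /pos_part ge_max le_max lexx/=.
by rewrite le_max gerBl (ltW d0) orbT.
Qed.

Lemma ramp_le0 d x : 0 < d -> x <= 0 -> ramp d x = 0.
Proof.
move=> d0 x0; rewrite /ramp /pos_part !max_l ?subrr ?mul0r//; lra.
Qed.

Lemma ramp_ge d x : 0 < d -> d <= x -> ramp d x = x - d / 2.
Proof.
move=> d0 x0; rewrite /ramp /pos_part !max_r; [|lra|lra].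
by field; rewrite gt_eqF.
Qed.

Definition heaviside x : R := if 0 < x then 1 else 0.

Variable d_ : nat -> R.
Hypothesis d_gt0 : forall n, 0 < d_ n.
Hypothesis d_cvg0 : d_ @ \oo --> 0.

Lemma step_cvg x : step (d_ n) x @[n --> \oo] --> heaviside x.
Proof.
rewrite /heaviside; have [x0|x0] := ltP 0 x; last first.
  apply: cvg_near_cst; apply: nearW => n.
  rewrite /step /pos_part !max_l ?subrr ?mul0r//.
  by have := d_gt0 n; lra.
apply: cvg_near_cst; near=> n.
have dx : d_ n < x by near: n; apply: cvgr_lt d_cvg0 _ x0.
rewrite /step /pos_part !max_r; [|lra|lra].
by field; rewrite gt_eqF.
Unshelve. all: by end_near. Qed.

Lemma ramp_cvg x : ramp (d_ n) x @[n --> \oo] --> pos_part x.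
Proof.
apply: (@squeeze_cvgr _ _ _ _ (fun n => pos_part x - d_ n) (cst (pos_part x))).
- by apply: nearW => n; exact: ramp_bound.
- by rewrite -[X in _ --> X]subr0; apply: cvgB => //; exact: cvg_cst.
- exact: cvg_cst.
Qed.

End ramp.

(** * Trapezoidal test functions and increments of primitives *)

Section weak_derivative.
Context {R : realType}.
Variable l : R.
Local Notation nu := (leb_I l).
Local Notation I := (Iset l).
Local Notation X := (L2 nu).
Local Notation prim := (@prim R l).
Implicit Types a b c d h x : R.

(** As [heaviside 0 = 0], the weight selects [x > a], exactly the complement of the half-line over
    which [prim] integrates. *)
Lemma prim_heaviside (u : X) (a : R) :
  \int[nu]_x (u x * heaviside (x - a)) = \int[nu]_x u x - prim u a.
Proof.
have ui := L2_integrable u.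
rewrite /prim (@Rintegral_mkcond _ (measurableTypeR R) R nu [set` `]-oo, a]]) -RintegralB//; last first.
  rewrite -restrict_EFin.
  refine (iffLR (@integrable_mkcond _ (measurableTypeR R) R nu _ _ _) _) => //.
  by apply: integrableS ui.
apply: eq_Rintegral => x _.
rewrite patchE /heaviside subr_gt0 ltNge mem_setE in_itv/=.
by case: (x <= a) => /=; rewrite ?mulr0 ?mulr1 ?subrr ?subr0.
Qed.

Lemma weak_deriv_test (u v : X) (phi dphi : R -> R) (a b : R) : weak_deriv u v ->
  (forall x : R, is_derive x 1 phi (dphi x)) -> continuous dphi ->
  0 < a -> b < l -> (forall x, x \notin `[a, b] -> phi x = 0) ->
  \int[nu]_x (u x * dphi x) = - \int[nu]_x (v x * phi x).
Proof.
move=> uv dP cd a0 bl phi0.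
have E : derive1 phi = dphi by apply/funext => x; rewrite derive1E derive_val.
rewrite -E; apply: uv; split; [|by rewrite E|by exists a, b].
by move=> x; exact: ex_derive.
Qed.

Definition ramps d a b h (x : R) : R :=
  (ramp d (x - a) - ramp d (x - (a + h))) - (ramp d (x - b) - ramp d (x - (b + h))).
Definition steps d a b h (x : R) : R :=
  (step d (x - a) - step d (x - (a + h))) - (step d (x - b) - step d (x - (b + h))).

Lemma is_derive_ramps (d a b h x : R) : 0 < d ->
  is_derive x 1 (ramps d a b h) (steps d a b h x).
Proof.
move=> d0.
have sh (c : R) : is_derive x 1 (fun y : R => ramp d (y - c)) (step d (x - c)).
  have := @is_derive1_comp _ (ramp d) (fun y => y - c) x (step d (x - c)) 1.
  rewrite mulr1; apply; first exact: is_derive_ramp.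
  have := is_deriveB (is_derive_id x 1) (is_derive_cst c x 1).
  by rewrite subr0.
by apply: is_deriveB; apply: is_deriveB.
Qed.

Lemma steps_continuous d a b h : continuous (steps d a b h).
Proof.
have sh (c : R) : continuous (fun y : R => step d (y - c)).
  move=> x; apply: (@continuous_comp _ _ _ (fun y => y - c) (step d));
    last exact: step_continuous.
  by apply: cvgB; [exact: cvg_id|exact: cvg_cst].
by move=> x; apply: cvgB; apply: cvgB; exact: sh.
Qed.

(** To the left of [a] all four ramps vanish; to the right of [b + h + d] each has become affine of
    slope 1, and they cancel. *)
Lemma ramps_support d a b h x : 0 < d -> 0 < h -> a < b ->
  x \notin `[a, b + h + d] -> ramps d a b h x = 0.
Proof.
move=> d0 h0 ab; rewrite in_itv/= negb_and -!ltNge => /orP[xa|xb].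
  by rewrite /ramps !ramp_le0 ?subrr ?subr0//; lra.
by rewrite /ramps !ramp_ge//; lra.
Qed.

(* The test functions [ramps d a b h], as [d] tends to 0, give the weak derivative
   identity for the trapezoid with slopes [1] on [a, a + h] and [-1] on [b, b + h]. *)
Lemma prim_increments (u v : X) (a b h : R) : weak_deriv u v ->
  0 < a -> a < b -> 0 < h -> b + h < l ->
  (prim u (a + h) - prim u a) - (prim u (b + h) - prim u b) =
  - \int[nu]_x (v x * ((pos_part (x - a) - pos_part (x - (a + h))) -
                       (pos_part (x - b) - pos_part (x - (b + h))))).
Proof.
move=> uv a0 ab h0 bhl.
(* At most half of the room between [b + h] and [l], so that the supports stay inside [I]. *)
pose d_ n : R := (l - (b + h)) / 2 * harmonic n.
have d0 n : 0 < d_ n by rewrite mulr_gt0 ?harmonic_gt0//; lra.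
have dl n : b + h + d_ n < l.
  have : d_ n <= (l - (b + h)) / 2 * 1.
    by rewrite ler_wpM2l ?invf_le1 ?ler1n//; lra.
  lra.
have dc : d_ @ \oo --> 0.
  by rewrite -(mulr0 ((l - (b + h)) / 2)); apply: cvgM; [exact: cvg_cst|exact: cvg_harmonic].
have mS n : measurable_fun (setT : set (measurableTypeR R)) (steps (d_ n) a b h).
  exact: continuous_measurable_fun (@steps_continuous _ _ _ _).
have mRa n : measurable_fun (setT : set (measurableTypeR R)) (ramps (d_ n) a b h).
  apply: continuous_measurable_fun => x.
  apply: differentiable_continuous; apply/derivable1_diffP.
  by have [] := @is_derive_ramps (d_ n) a b h x (d0 n).
have H n := weak_deriv_test uv (fun x => is_derive_ramps a b h x (d0 n))
  (@steps_continuous (d_ n) a b h) a0 (dl n) (fun x => ramps_support (d0 n) h0 ab).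
pose Hs x : R := (heaviside (x - a) - heaviside (x - (a + h))) -
                 (heaviside (x - b) - heaviside (x - (b + h))).
pose Ps x : R := (pos_part (x - a) - pos_part (x - (a + h))) -
                 (pos_part (x - b) - pos_part (x - (b + h))).
have E : \int[nu]_x (u x * Hs x) = - \int[nu]_x (v x * Ps x).
  have L : \int[nu]_x (u x * steps (d_ n) a b h x) @[n --> \oo] --> \int[nu]_x (u x * Hs x).
    apply: (@cvg_L2_bounded _ _ u _ Hs 4 mS).
      move=> n x; have := step_bound (x - a) (d0 n); have := step_bound (x - (a + h)) (d0 n).
      have := step_bound (x - b) (d0 n); have := step_bound (x - (b + h)) (d0 n).
      rewrite ler_norml /steps => /andP[? ?] /andP[? ?] /andP[? ?] /andP[? ?].
      by apply/andP; split; lra.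
    by move=> x; apply: cvgB; apply: cvgB; exact: step_cvg.
  have L' : \int[nu]_x (v x * ramps (d_ n) a b h x) @[n --> \oo] --> \int[nu]_x (v x * Ps x).
    apply: (@cvg_L2_bounded _ _ v _ Ps (4 * l) mRa).
      (* The single ramps are unbounded on the line; on the support, [x < l] bounds each of them by
         [l], and elsewhere their combination is 0. *)
      move=> n x; have [xI|xI] := boolP (x \in `[a, b + h + d_ n]); last first.
        by rewrite (ramps_support (d0 n) h0 ab xI) normr0; lra.
      move: xI; rewrite in_itv/= => /andP[ax xb].
      have rb c : 0 <= c -> 0 <= ramp (d_ n) (x - c) <= l.
        move=> c0; apply/andP; split; first exact: ramp_ge0.
        have /andP[_ /le_trans] := ramp_bound (x - c) (d0 n); apply.
        by rewrite /pos_part ge_max; apply/andP; split; have := dl n; lra.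
      have a0' := ltW a0; have b0' : 0 <= b by lra.
      have ah0' : 0 <= a + h by lra. have bh0' : 0 <= b + h by lra.
      rewrite ler_norml /ramps.
      have /andP[? ?] := rb a a0'; have /andP[? ?] := rb (a + h) ah0'.
      have /andP[? ?] := rb b b0'; have /andP[? ?] := rb (b + h) bh0'.
      by apply/andP; split; lra.
    by move=> x; apply: cvgB; apply: cvgB; exact: ramp_cvg.
  rewrite -(cvg_lim (@Rhausdorff R) L) -(cvg_lim (@Rhausdorff R) (cvgN L')).
  by congr (limn _); apply/funext => n /=; rewrite H.
rewrite -/(Ps _) -E /Hs.
have hv c : nu.-integrable setT (EFin \o (fun x => u x * heaviside (x - c))).
  apply: (@L2_integrableM_bounded _ _ _ _ 1).
    apply: (@measurable_fun_cvg _ _ _ _ (fun n x => step (d_ n) (x - c))).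
      move=> n; apply: continuous_measurable_fun.
      move=> x; apply: (@continuous_comp _ _ _ (fun y => y - c) (step (d_ n)));
        last exact: step_continuous.
      by apply: cvgB; [exact: cvg_id|exact: cvg_cst].
    by move=> x _; exact: step_cvg.
  by move=> x; rewrite /heaviside; case: ifP; rewrite ?normr1 ?normr0.
under eq_Rintegral do rewrite !mulrBr.
have hvB c c' : nu.-integrable setT
    (EFin \o (fun x => u x * heaviside (x - c) - u x * heaviside (x - c'))).
  exact: (@integrableB _ _ _ _ _ _ _ _ (hv c) (hv c')).
rewrite RintegralB// !RintegralB// !prim_heaviside; ring.
Qed.

End weak_derivative.

(** * Elements of H^1 as primitives, and uniqueness of weak derivatives *)

Section primitive_representation.
Context {R : realType}.
Variable l : R.
Local Notation nu := (leb_I l).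
Local Notation I := (Iset l).
Local Notation X := (L2 nu).
Local Notation prim := (@prim R l).

Lemma cvg_difference_quotient (f : R -> R) (a df : R) (h_ : nat -> R) :
  is_derive a 1 f df -> (forall n, h_ n != 0) -> h_ @ \oo --> 0 ->
  (f (a + h_ n) - f a) / h_ n @[n --> \oo] --> df.
Proof.
move=> [fa <-] h_neq0 h_cvg0.
have /cvgr_dnbhsP/(_ h_) H : (h^-1 *: (f (h *: 1 + a) - f a)) @[h --> (0:R)^'] --> 'D_1 f a by exact: fa.
have := H (conj h_neq0 h_cvg0); rewrite (_ : (fun n => _) = (fun n => (f (a + h_ n) - f a) / h_ n))//.
by apply/funext => n; rewrite [h_ n *: 1]mulr1 (addrC (h_ n)) [LHS]mulrC.
Qed.

Lemma cvg_scale_harmonic (C : R) : C * harmonic n @[n --> \oo] --> 0.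
Proof. by rewrite -(mulr0 C); apply: cvgM; [exact: cvg_cst|exact: cvg_harmonic]. Qed.

(* Divide [prim_increments] by [h] and let [h] tend to 0. *)
Lemma prim_difference (u v : X) (a b ua ub : R) : weak_deriv u v ->
  0 < a -> a < b -> b < l ->
  is_derive a 1 (prim u) ua -> is_derive b 1 (prim u) ub ->
  ua - ub = prim v a - prim v b.
Proof.
move=> uv a0 ab bl dua dub.
pose h_ n : R := (l - b) / 2 * harmonic n.
have h0 n : 0 < h_ n by rewrite mulr_gt0 ?harmonic_gt0//; lra.
have hn0 n : h_ n != 0 by rewrite gt_eqF.
have hl n : b + h_ n < l.
  have : h_ n <= (l - b) / 2 * 1 by rewrite ler_wpM2l ?invf_le1 ?ler1n//; lra.
  lra.
have hc : h_ @ \oo --> 0 by exact: cvg_scale_harmonic.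
have mst (h c : R) : measurable_fun (setT : set (measurableTypeR R)) (fun x => step h (x - c)).
  apply: continuous_measurable_fun.
  move=> x; apply: (@continuous_comp _ _ _ (fun y => y - c) (step h));
    last exact: step_continuous.
  by apply: cvgB; [exact: cvg_id|exact: cvg_cst].
have sb (h c x : R) : 0 < h -> `|step h (x - c)| <= 1.
  by move=> hp; have /andP[s0 s1] := step_bound (x - c) hp; rewrite ger0_norm.
(* The trapezoid divided by its height [h_ n]; its limit is the indicator of []a, b]]. *)
pose S n (x : R) := step (h_ n) (x - a) - step (h_ n) (x - b).
have mS n : measurable_fun (setT : set (measurableTypeR R)) (S n) by apply: measurable_funB.
have Sb n x : `|S n x| <= 2.
  apply: le_trans (ler_normB _ _) _.
  by have := sb _ a x (h0 n); have := sb _ b x (h0 n); lra.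
have E n : (prim u (a + h_ n) - prim u a) / h_ n - (prim u (b + h_ n) - prim u b) / h_ n
    = - \int[nu]_x (v x * S n x).
  rewrite -mulrBl (prim_increments uv a0 ab (h0 n) (hl n)) mulNr; congr (- _).
  apply: (mulIf (hn0 n)); rewrite divfK// -RintegralZr//; last exact: L2_integrableM_bounded.
  apply: eq_Rintegral => x _; rewrite /S /step.
  by rewrite !opprD !addrA; field.
have L1 : ((prim u (a + h_ n) - prim u a) / h_ n -
    (prim u (b + h_ n) - prim u b) / h_ n) @[n --> \oo] --> ua - ub.
  by apply: cvgB; exact: cvg_difference_quotient.
have L2 : (- \int[nu]_x (v x * S n x)) @[n --> \oo] -->
    - \int[nu]_x (v x * (heaviside (x - a) - heaviside (x - b))).
  apply: cvgN; apply: (@cvg_L2_bounded _ _ v _ _ 2) => //.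
  by move=> x; apply: cvgB; exact: step_cvg.
rewrite -(cvg_lim (@Rhausdorff R) L1).
rewrite (_ : (fun n => _) = (fun n => - \int[nu]_x (v x * S n x))); last first.
  by apply/funext => n; rewrite -E.
rewrite (cvg_lim (@Rhausdorff R) L2).
have hv c : nu.-integrable setT (EFin \o (fun x => v x * heaviside (x - c))).
  apply: (@L2_integrableM_bounded _ _ _ _ 1).
    apply: (@measurable_fun_cvg _ _ _ _ (fun n (x : R) => step (h_ n) (x - c)));
      [by move=> n; exact: mst|move=> x _].
    exact: step_cvg.
  by move=> x; rewrite /heaviside; case: ifP; rewrite ?normr1 ?normr0.
under eq_Rintegral do rewrite mulrBr.
by rewrite RintegralB// !prim_heaviside; ring.
Qed.

(** Almost everywhere [u] is the derivative of [prim u], and by [prim_difference] the difference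
    [u - prim v] takes the same value at any two such points of [I]. *)
Lemma weak_deriv_prim (u v : X) : weak_deriv u v ->
  exists c : R, {ae nu, forall x, u x = c + prim v x}.
Proof.
move=> uv; have G := prim_derive_ae (L2_integrable u).
have [[a [Ia Ga]]|nG] := pselect (exists a, I a /\ is_derive a 1 (prim u) (u a)).
  exists (u a - prim v a); apply: filterS2 (ae_in_I l) G => x Ix Gx.
  move: Ia Ix; rewrite /Iset/= !in_itv/= => /andP[a0 al] /andP[x0 xl].
  have [ax|xa|->] := ltgtP a x; last by rewrite subrK.
    by have := prim_difference uv a0 ax xl Ga Gx; lra.
  by have := prim_difference uv x0 xa al Gx Ga; lra.
(* Without a base point almost no point lies in [I], so every constant does; this covers an empty
   [I]. *)
exists 0; apply: filterS2 (ae_in_I l) G => x Ix Gx.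
by exfalso; apply: nG; exists x.
Qed.

(** By [prim_difference] with [u = 0], the primitive of [v] is constant on [I], while its derivative
    is [v] almost everywhere. *)
Lemma weak_deriv0 (v : X) : weak_deriv 0 v -> v = 0.
Proof.
move=> zv; apply: eqL2.
have p0 : prim (0 : X) = cst 0.
  apply/funext => x; rewrite /prim Rintegral_mkcond.
  transitivity (\int[nu]_t (cst 0 t : R)); last by rewrite Rintegral_cst// mul0r.
  apply: ae_eq_Rintegral => //.
    by apply/(measurable_restrictT _ _).1 => //; exact: measurable_funTS.
  by apply: filterS (L2_fun0 nu) => t E; rewrite patchE E; case: ifP.
have dp0 (x : R) : is_derive x 1 (prim (0 : X)) 0 by rewrite p0; exact: is_derive_cst.
have pv a b : 0 < a -> a < b -> b < l -> prim v b = prim v a.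
  by move=> a0 ab bl; have := prim_difference zv a0 ab bl (dp0 a) (dp0 b); lra.
apply: filterS3 (ae_in_I l) (prim_derive_ae (L2_integrable v)) (L2_fun0 nu) => x Ix Gx ->.
move: Ix; rewrite /Iset/= in_itv/= => /andP[x0 xl].
pose h_ n : R := (l - x) / 2 * harmonic n.
have h0 n : 0 < h_ n by rewrite mulr_gt0 ?harmonic_gt0//; lra.
have hn0 n : h_ n != 0 by rewrite gt_eqF.
have hl n : x + h_ n < l.
  have : h_ n <= (l - x) / 2 * 1 by rewrite ler_wpM2l ?invf_le1 ?ler1n//; lra.
  lra.
have := cvg_difference_quotient Gx hn0 (cvg_scale_harmonic _).
move=> /(cvg_lim (@Rhausdorff R)) <-; apply/cvg_lim => //.
apply: cvg_near_cst; apply: nearW => n.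
by rewrite (pv x)// ?subrr ?mul0r//; have := h0 n; lra.
Qed.

End primitive_representation.

(** * Multiplication by essentially bounded functions *)

Section multiplication.
Context {R : realType}.
Variable l : R.
Local Notation nu := (leb_I l).
Local Notation X := (L2 nu).

Variable a : R -> R.
Hypothesis aoo : a \in Lfun nu +oo%E.

Lemma Lfun_oo_bounded : exists C : R, 0 <= C /\ {ae nu, forall x, `|a x| <= C}.
Proof.
move: aoo; rewrite inE => /andP[_]; rewrite inE/= /finite_norm unlock /Lnorm.
case: ifPn => [_ H|].
  have [|C HC] := @ess_supr_bounded _ _ _ nu (fun x => `|a x|).
    by apply: le_lt_trans H; rewrite le_eqVlt; apply/orP; left; apply/eqP; congr (ess_sup _ _).
  exists (Num.max 0 C); rewrite le_max lexx; split=> //.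
  by apply: filterS HC => x; rewrite le_max => ->; rewrite orbT.
(* Here the whole space is null: the norm of order [+oo] is an essential supremum only on a space of
   positive measure. *)
rewrite -leNgt => n0 _; exists 0; split=> //.
exists setT; split => //; apply/eqP; rewrite eq_le measure_ge0 andbT; exact: n0.
Qed.

Lemma Lfun_mulop (u : X) : (fun x => a x * u x) \in Lfun nu 2%:E.
Proof.
have [C [C0 aC]] := Lfun_oo_bounded.
have mau : measurable_fun (setT : set (measurableTypeR R)) (fun x => a x * u x).
  by apply: measurable_funM => //; exact: Lfun_measurable aoo.
rewrite inE; apply/andP; split; rewrite inE//=.
rewrite /finite_norm unlock /Lnorm poweR_lty//.
have := Lfun_integrable (ler1n R 2) (@Lfun_scale _ _ _ nu u C 2 (ler1n R 2) (L2_fun_Lfun u)).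
move=> /integrableP[mu fi]; apply: le_lt_trans fi.
apply: ae_ge0_le_integral => //.
- by move=> x _; rewrite /= lee_fin powR_ge0.
- apply/measurable_EFinP.
  apply: (@measurableT_comp _ _ _ _ _ _ (@powR R ^~ 2)) => //.
  exact: measurableT_comp.
- exact: measurableT_comp.
- apply: filterS aC => x ax _; rewrite /= lee_fin (ger0_norm (powR_ge0 _ _)).
  rewrite ge0_ler_powR// ?nnegrE// !normrM mulrC (ger0_norm C0).
  by rewrite ler_wpM2l.
Qed.

Lemma mulopE (u : X) : {ae nu, forall x, mulop a u x = a x * u x}.
Proof. exact: L2_classE (Lfun_mulop u). Qed.

Lemma mulop_eq (u w : X) : {ae nu, forall x, w x = a x * u x} -> mulop a u = w.
Proof.
by move=> H; apply: eqL2; apply: filterS2 (mulopE u) H => x -> ->.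
Qed.

Lemma mulopD (u v : X) : mulop a (u + v) = mulop a u + mulop a v.
Proof.
apply: mulop_eq; apply: filter_app (L2_funD (mulop a u) (mulop a v)).
apply: filterS3 (mulopE u) (mulopE v) (L2_funD u v) => x E1 E2 E3 E4.
by rewrite E4 E3 E1 E2 mulrDr.
Qed.

Lemma mulopZ (c : R) (u : X) : mulop a (c *: u) = c *: mulop a u.
Proof.
apply: mulop_eq.
apply: filterS3 (mulopE u) (L2_funZ c u) (L2_funZ c (mulop a u)) => x E1 E2 E3.
by rewrite E3 E2 E1 mulrCA.
Qed.

Lemma measurable_mulop (u v : X) :
  measurable_fun (setT : set (measurableTypeR R)) (fun x => a x * u x * v x).
Proof.
by apply: measurable_funM => //; apply: measurable_funM => //; exact: Lfun_measurable aoo.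
Qed.

Lemma inner_mulop (u v : X) : L2_inner (mulop a u) v = \int[nu]_x (a x * u x * v x).
Proof.
apply: ae_eq_Rintegral; [exact: measurable_funM|exact: measurable_mulop|].
by apply: filterS (mulopE u) => x ->.
Qed.

Lemma mulop_sym (u v : X) : L2_inner (mulop a u) v = L2_inner u (mulop a v).
Proof.
rewrite (L2_innerC u) !inner_mulop; apply: eq_Rintegral => x _; ring.
Qed.

(** An essential bound [C] of [a] makes [(C - a) u^2] nonnegative almost everywhere. For
    [a = alpha1] this controls the zeroth order part of the quadratic form of [An]. *)
Lemma inner_mulop_le : exists2 C : R, 0 <= C &
  forall u : X, L2_inner (mulop a u) u <= C * `|u| ^+ 2.
Proof.
have [C [C0 aC]] := Lfun_oo_bounded; exists C => // u.
rewrite -L2_inner_self -L2_innerZl -subr_ge0 -L2_innerBl.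
(* The absolute value turns nonnegativity almost everywhere into nonnegativity everywhere, without
   changing the integral. *)
have Eae : {ae nu, forall x, (C *: u - mulop a u : X) x * u x = `|(C - a x) * u x * u x|}.
  apply: filter_app (L2_funD (C *: u) (- mulop a u)).
  have EN : {ae nu, forall x, (- mulop a u : X) x = - (mulop a u x)}.
    by rewrite -scaleN1r; apply: filterS (L2_funZ (-1) (mulop a u)) => x ->; rewrite mulN1r.
  apply: filter_app EN.
  apply: filterS3 (mulopE u) (L2_funZ C u) aC => x E1 E2 E3 E4 E5.
  rewrite E5 E4 E2 E1 ger0_norm -?mulrA; last first.
    by rewrite mulr_ge0 ?subr_ge0 -?expr2 ?sqr_ge0// (le_trans (ler_norm _)).
  by ring.
rewrite /L2_inner
  (@ae_eq_Rintegral _ (measurableTypeR R) _ nu _ (fun x => `|(C - a x) * u x * u x|))//.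
- exact: Rintegral_ge0.
- exact: measurable_funM.
- apply: measurableT_comp => //; apply: measurable_funM => //; apply: measurable_funM => //.
  by apply: measurable_funB => //; exact: Lfun_measurable aoo.
Qed.

End multiplication.

(** * Linearity of the Sobolev spaces and integration by parts *)

Section sobolev.
Context {R : realType}.
Variable l : R.
Hypothesis l_gt0 : 0 < l.
Local Notation nu := (leb_I l).
Local Notation I := (Iset l).
Local Notation X := (L2 nu).

(** Almost every point lies in [[0, l]], where the extreme value theorem bounds [F]. *)
Lemma Lfun_continuous (F : R -> R) : continuous F -> F \in Lfun nu 2%:E.
Proof.
move=> cF.
have mF : measurable_fun (setT : set (measurableTypeR R)) F by exact: continuous_measurable_fun.
have [c _ cmax] : exists2 c, c \in `[0, l] & forall t, t \in `[0, l] -> `|F t| <= `|F c|.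
  apply: (@EVT_max _ (fun x => `|F x|)); first exact: ltW.
  by apply: continuous_subspaceT => x; apply: cvg_norm; exact: cF.
rewrite inE; apply/andP; split; rewrite inE//=.
rewrite /finite_norm unlock /Lnorm poweR_lty//.
apply: (@le_lt_trans _ _ (\int[nu]_x (`|F c| `^ 2)%:E)%E); last first.
  by rewrite integral_cst// ltey_eq fin_numM// leb_I_setT_fin.
apply: ae_ge0_le_integral => //.
- by move=> x _; rewrite /= lee_fin powR_ge0.
- apply/measurable_EFinP.
  apply: (@measurableT_comp _ _ _ _ _ _ (@powR R ^~ 2)) => //.
  exact: measurableT_comp.
- have := ae_in_I l; apply: filterS => x; rewrite /Iset/= in_itv/= => /andP[x0 xl] _.
  rewrite /= lee_fin ge0_ler_powR// ?nnegrE//.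
  by apply: cmax; rewrite in_itv/= !ltW.
Qed.

Lemma test_fun_Lfun (phi : R -> R) : test_fun l phi ->
  phi \in Lfun nu 2%:E /\ derive1 phi \in Lfun nu 2%:E.
Proof.
move=> [dphi cphi _]; split; apply: Lfun_continuous => // x.
by apply: differentiable_continuous; exact/derivable1_diffP.
Qed.

(** In this form the relation is visibly linear in the pair [u], [v]. *)
Lemma weak_derivP (u v : X) : weak_deriv u v <-> forall phi, test_fun l phi ->
  L2_inner u (L2_class nu (derive1 phi)) = - L2_inner v (L2_class nu phi).
Proof.
by split=> H phi tphi; have [L1 L2] := test_fun_Lfun tphi; have := H phi tphi;
  rewrite !L2_inner_class.
Qed.

Lemma weak_derivD (u1 u2 v1 v2 : X) : weak_deriv u1 v1 -> weak_deriv u2 v2 ->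
  weak_deriv (u1 + u2) (v1 + v2).
Proof.
move=> /weak_derivP H1 /weak_derivP H2; apply/weak_derivP => phi tphi.
by rewrite !L2_innerDl H1// H2// opprD.
Qed.

Lemma weak_derivZ (a : R) (u v : X) : weak_deriv u v -> weak_deriv (a *: u) (a *: v).
Proof.
move=> /weak_derivP H; apply/weak_derivP => phi tphi.
by rewrite !L2_innerZl H// mulrN.
Qed.

(** Two weak derivatives of [u] differ by a weak derivative of 0, so the choice made by [xget] is
    forced. *)
Lemma DxE (u v : X) : weak_deriv u v -> Dx u = v.
Proof.
move=> uv; rewrite /Dx; case: xgetP => [w _ uw|/(_ v)//].
apply/eqP; rewrite -subr_eq0; apply/eqP/weak_deriv0.
have := weak_derivD uw (weak_derivZ (-1) uv).
by rewrite !scaleN1r subrr.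
Qed.

Lemma H1_weak_deriv (u : X) : H1 u -> weak_deriv u (Dx u).
Proof. by move=> [v uv]; rewrite (DxE uv). Qed.

Lemma weak_deriv_H1 (u v : X) : weak_deriv u v -> H1 u.
Proof. by exists v. Qed.

Lemma H1_lin (a : R) (u v : X) : H1 u -> H1 v ->
  H1 (a *: u + v) /\ Dx (a *: u + v) = a *: Dx u + Dx v.
Proof.
move=> /H1_weak_deriv hu /H1_weak_deriv hv.
have H := weak_derivD (weak_derivZ a hu) hv.
by split; [exact: weak_deriv_H1 H|exact: DxE].
Qed.

Lemma H1_0 : H1 (0 : X) /\ Dx (0 : X) = 0.
Proof.
have H : weak_deriv (0 : X) (0 : X).
  by apply/weak_derivP => phi _; rewrite !L2_inner0l oppr0.
by split; [exact: weak_deriv_H1 H|exact: DxE].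
Qed.

Lemma H2_lin (a : R) (u v : X) : H2 u -> H2 v ->
  H2 (a *: u + v) /\ Dx (Dx (a *: u + v)) = a *: Dx (Dx u) + Dx (Dx v).
Proof.
move=> [u1 u2] [v1 v2]; have [A E] := H1_lin a u1 v1.
by have [B F] := H1_lin a u2 v2; rewrite /H2/= E.
Qed.

Lemma L2_class_eq (F : R -> R) (w : X) : {ae nu, forall x, w x = F x} ->
  L2_class nu F = w.
Proof.
move=> wF; rewrite /L2_class; case: xgetP => [h _ hF|/(_ w)//].
by apply: eqL2; apply: filterS2 wF hF => x -> ->.
Qed.

Lemma test_fun_lin (a : R) (phi psi : R -> R) : test_fun l phi -> test_fun l psi ->
  test_fun l (fun x => a * phi x + psi x) /\
  derive1 (fun x => a * phi x + psi x) = (fun x => a * derive1 phi x + derive1 psi x).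
Proof.
move=> [d1 c1 [a1 [b1 [a10 b1l s1]]]] [d2 c2 [a2 [b2 [a20 b2l s2]]]].
have D (x : R) : is_derive x 1 (fun x => a * phi x + psi x) (a * derive1 phi x + derive1 psi x).
  rewrite !derive1E; apply: is_deriveD; last exact: derivableP.
  by apply: is_deriveZ; exact: derivableP.
have E : derive1 (fun x => a * phi x + psi x) = (fun x => a * derive1 phi x + derive1 psi x).
  by apply/funext => x; rewrite derive1E derive_val.
split; last exact: E.
split.
- by move=> x; exact: ex_derive.
- by rewrite E => x; apply: cvgD; [apply: cvgM; [exact: cvg_cst|exact: c1]|exact: c2].
- exists (Num.min a1 a2), (Num.max b1 b2); split.
  + by rewrite lt_min a10.
  + by rewrite gt_max b1l.
  + move=> x; rewrite in_itv/= ge_min le_max => H.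
    rewrite s1 ?s2 ?mulr0 ?addr0//; rewrite in_itv/=; apply: contra H => /andP[-> ->].
      by rewrite !orbT.
    by [].
Qed.

Lemma L2_class_lin (a : R) (F G : R -> R) : F \in Lfun nu 2%:E -> G \in Lfun nu 2%:E ->
  L2_class nu (fun x => a * F x + G x) = a *: L2_class nu F + L2_class nu G.
Proof.
move=> LF LG; apply: L2_class_eq.
apply: filter_app (L2_funD (a *: L2_class nu F) (L2_class nu G)).
apply: filterS3 (L2_funZ a (L2_class nu F)) (L2_classE LF) (L2_classE LG) => x E1 E2 E3 ->.
by rewrite E1 E2 E3.
Qed.

Lemma H10_lin (a : R) (u v : X) : H10 u -> H10 v -> H10 (a *: u + v).
Proof.
move=> [u1 ua] [v1 va]; have [w1 E] := H1_lin a u1 v1; split=> // e e0.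
(* The summand 1 keeps the tolerance [e / (|a| + 1) / 2] meaningful when [a = 0]. *)
have a0 : 0 < `|a| + 1 by rewrite ltr_wpDl.
have [phi tphi [p1 p2]] := ua (e / (`|a| + 1) / 2) ltac:(by rewrite !divr_gt0).
have [psi tpsi [q1 q2]] := va (e / 2) ltac:(by rewrite divr_gt0).
have [t dt] := test_fun_lin a tphi tpsi.
have [L1 L2] := test_fun_Lfun tphi; have [L3 L4] := test_fun_Lfun tpsi.
have est (f g f' g' : X) : `|f - f'| < e / (`|a| + 1) / 2 -> `|g - g'| < e / 2 ->
    `|a *: f + g - (a *: f' + g')| < e.
  move=> H H'.
  have -> : a *: f + g - (a *: f' + g') = a *: (f - f') + (g - g').
    by rewrite scalerBr opprD addrACA.
  apply: le_lt_trans (ler_normD _ _) _; rewrite normrZ [ltRHS](splitr e).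
  apply: ler_ltD => //.
  apply: (@le_trans _ _ ((`|a| + 1) * (e / (`|a| + 1) / 2))).
    by apply: ler_pM => //; [rewrite lerDl|exact: ltW].
  by rewrite le_eqVlt; apply/orP; left; apply/eqP; field; rewrite gt_eqF.
exists (fun x => a * phi x + psi x) => //.
by split; rewrite ?dt ?E L2_class_lin//; exact: est.
Qed.

Lemma test_fun0 : test_fun l (cst 0 : R -> R) /\ derive1 (cst 0 : R -> R) = cst 0.
Proof.
have E : derive1 (cst 0 : R -> R) = cst 0.
  by apply/funext => x; rewrite derive1E derive_cst.
split=> //; split=> //; first by rewrite E => x; exact: cvg_cst.
exists (l / 2), (l / 2); split; last by [].
  by rewrite divr_gt0.
by have := l_gt0; lra.
Qed.

Lemma H10_0 : H10 (0 : X).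
Proof.
have [h0 d0] := H1_0; split=> // e e0; have [t dt] := test_fun0.
exists (cst 0) => //; rewrite dt d0.
have -> : L2_class nu (cst 0) = 0 by apply: L2_class_eq; exact: L2_fun0.
by rewrite subrr normr0.
Qed.

(** For a test function in place of [v] this is the definition of the weak derivative; both sides
    are continuous in [v] for the H^1 norm, in which test functions approximate [v]. *)
Lemma integration_by_parts_H10 (u v : X) : H1 u -> H10 v ->
  L2_inner (Dx u) v = - L2_inner u (Dx v).
Proof.
move=> hu [hv va]; have /weak_derivP wu := H1_weak_deriv hu.
apply/eqP; rewrite -addr_eq0 -normr_le0; apply/ler_addgt0Pl => e e0; rewrite addr0.
pose C := `|Dx u| + `|u| + 1.
have C0 : 0 < C by rewrite ltr_wpDl// addr_ge0.
have [phi tphi [p1 p2]] := va (e / C) ltac:(by rewrite divr_gt0).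
have -> : L2_inner (Dx u) v + L2_inner u (Dx v) =
    L2_inner (Dx u) (v - L2_class nu phi) + L2_inner u (Dx v - L2_class nu (derive1 phi)).
  by rewrite !L2_innerBr wu//; ring.
apply: le_trans (ler_normD _ _) _.
apply: (@le_trans _ _ (`|Dx u| * (e / C) + `|u| * (e / C))).
  apply: lerD; apply: le_trans (L2_cauchy_schwarz _ _) _.
    by rewrite ler_wpM2l// ltW.
  by rewrite ler_wpM2l// ltW.
rewrite -mulrDl mulrA ler_pdivrMr// mulrC ler_pM2l// /C; lra.
Qed.

End sobolev.

(** * Unique continuation *)

Section gronwall.
Context {R : realType}.

(* Bounding [m] by the increment of a primitive [Phi] covers both sides of [x0]. *)
Lemma gronwall (m Phi : R -> R) (K a b x0 : R) : 0 <= K -> x0 \in `]a, b[ ->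
  (forall x : R, x \in `]a, b[ -> is_derive x 1 Phi (m x)) ->
  (forall x : R, x \in `]a, b[ -> 0 <= m x) ->
  (forall x : R, x \in `]a, b[ -> m x <= K * `|Phi x - Phi x0|) ->
  forall x : R, x \in `]a, b[ -> m x = 0.
Proof.
move=> K0 x0ab dPhi m0 mK.
have sub y z t : y \in `]a, b[ -> z \in `]a, b[ -> t \in `[y, z] -> t \in `]a, b[.
  rewrite !in_itv/= => /andP[ay yb] /andP[az zb] /andP[yt tz].
  by rewrite (lt_le_trans ay yt) (le_lt_trans tz zb).
have Phi_mono y z : y \in `]a, b[ -> z \in `]a, b[ -> y <= z -> Phi y <= Phi z.
  move=> yI zI yz; apply: (@ger0_derive1_ndecr _ Phi y z) => //.
  - by move=> t /subset_itv_oo_cc /(sub _ _ _ yI zI) /dPhi [].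
  - move=> t /subset_itv_oo_cc /(sub _ _ _ yI zI) tI; have dt := dPhi t tI.
    by rewrite derive1E derive_val m0.
  - by apply: derivable_within_continuous => t /(sub _ _ _ yI zI) /dPhi [].
move=> x xI; apply/eqP; rewrite eq_le m0// andbT; apply: le_trans (mK x xI) _.
suff -> : Phi x = Phi x0 by rewrite subrr normr0 mulr0.
have dexp (c t : R) : is_derive t 1 (fun y => expR (c * y)) (expR (c * t) * c).
  have H : is_derive t 1 (fun y : R => c * y) c.
    by have := is_deriveZ c (is_derive_id t (1 : R)); rewrite [c *: 1]mulr1.
  exact: (is_derive1_comp (is_derive_expR _) H).
have [x0x|xx0] := leP x0 x; apply/eqP; rewrite eq_le.
  rewrite (Phi_mono _ _ x0ab xI x0x) andbT.
  (* To the right of [x0], [Phi' <= K (Phi - Phi x0)] makes [F] nonincreasing from the value 0,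
     whereas [Phi] is nondecreasing. *)
  pose F y := (Phi y - Phi x0) * expR (- K * y).
  have dF t : t \in `[x0, x] ->
      is_derive t 1 F ((m t - K * (Phi t - Phi x0)) * expR (- K * t)).
    move=> tI; have tab := sub _ _ _ x0ab xI tI; have dt := dPhi t tab.
    have dt' : is_derive t 1 (fun y => Phi y - Phi x0) (m t).
      by rewrite -[m t]subr0; apply: is_deriveB.
    have := is_deriveM dt' (dexp (- K) t); rewrite /GRing.scale/= => H.
    by apply: is_derive_eq H _; ring.
  have : F x <= F x0.
    apply: (@ler0_derive1_nincr _ F x0 x) => //.
    - by move=> t /subset_itv_oo_cc /dF [].
    - move=> t /subset_itv_oo_cc tI; have dt := dF t tI.
      rewrite derive1E derive_val pmulr_lle0 ?expR_gt0// subr_le0.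
      have tab := sub _ _ _ x0ab xI tI; apply: le_trans (mK t tab) _.
      rewrite ger0_norm// subr_ge0 Phi_mono//.
      by move: tI; rewrite in_itv/= => /andP[].
    - by apply: derivable_within_continuous => t /dF [].
  by rewrite /F subrr mul0r pmulr_lle0 ?expR_gt0// subr_le0.
rewrite (Phi_mono _ _ xI x0ab (ltW xx0))/=.
(* The mirror argument: to the left of [x0], [F] is nondecreasing and reaches 0 at [x0]. *)
pose F y := (Phi x0 - Phi y) * expR (K * y).
have dF t : t \in `[x, x0] ->
    is_derive t 1 F ((K * (Phi x0 - Phi t) - m t) * expR (K * t)).
  move=> tI; have tab := sub _ _ _ xI x0ab tI; have dt := dPhi t tab.
  have dt' : is_derive t 1 (fun y => Phi x0 - Phi y) (- m t).
    by rewrite -[- m t]add0r; apply: is_deriveB.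
  have := is_deriveM dt' (dexp K t); rewrite /GRing.scale/= => H.
  by apply: is_derive_eq H _; ring.
have : F x <= F x0.
  apply: (@ger0_derive1_ndecr _ F x x0) => //; last exact: ltW.
  - by move=> t /subset_itv_oo_cc /dF [].
  - move=> t /subset_itv_oo_cc tI; have dt := dF t tI.
    rewrite derive1E derive_val pmulr_lge0 ?expR_gt0// subr_ge0.
    have tab := sub _ _ _ xI x0ab tI; apply: le_trans (mK t tab) _.
    rewrite distrC ger0_norm// subr_ge0 Phi_mono//.
    by move: tI; rewrite in_itv/= => /andP[].
  - by apply: derivable_within_continuous => t /dF [].
by rewrite /F subrr mul0r pmulr_lle0 ?expR_gt0// subr_le0.
Qed.

End gronwall.

(** * Continuity of primitives, zero sets and unique continuation *)

Section unique_continuation.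
Context {R : realType}.
Variable l : R.
Hypothesis l_gt0 : 0 < l.
Local Notation nu := (leb_I l).
Local Notation I := (Iset l).
Local Notation X := (L2 nu).
Local Notation prim := (@prim R l).

Lemma ae_le_Rintegral (F G : R -> R) : nu.-integrable setT (EFin \o F) ->
  nu.-integrable setT (EFin \o G) -> {ae nu, forall x, F x <= G x} ->
  \int[nu]_x F x <= \int[nu]_x G x.
Proof.
move=> iF iG FG; rewrite -subr_ge0 -RintegralB//.
have mF : measurable_fun (setT : set (measurableTypeR R)) F.
  by apply/measurable_EFinP; exact: measurable_int iF.
have mG : measurable_fun (setT : set (measurableTypeR R)) G.
  by apply/measurable_EFinP; exact: measurable_int iG.
rewrite (@ae_eq_Rintegral _ (measurableTypeR R) _ nu _ (fun x => `|G x - F x|)).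
- exact: Rintegral_ge0.
- exact: measurable_funB.
- by apply: measurableT_comp => //; exact: measurable_funB.
- by apply: filterS FG => x FGx; rewrite ger0_norm// subr_ge0.
Qed.

Lemma integrable_indic (f : R -> R) (A : set (measurableTypeR R)) : measurable A ->
  nu.-integrable setT (EFin \o f) ->
  nu.-integrable setT (EFin \o (fun x => f x * \1_A x)).
Proof.
move=> mA fi.
have : nu.-integrable setT ((EFin \o f) \_ A).
  refine (iffLR (@integrable_mkcond _ (measurableTypeR R) R nu A _ mA) _).
  by apply: integrableS fi.
apply: eq_integrable => // x _; rewrite patchE /= indicE.
by case: (x \in A); rewrite ?mulr1 ?mulr0.
Qed.

Lemma prim_indic (f : R -> R) (x : R) : prim f x = \int[nu]_t (f t * \1_(`]-oo, x]) t).
Proof.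
rewrite /prim Rintegral_mkcond; apply: eq_Rintegral => t _.
by rewrite patchE indicE; case: (t \in _); rewrite ?mulr1 ?mulr0.
Qed.

Lemma prim_diff (f : R -> R) (x y : R) : nu.-integrable setT (EFin \o f) -> x <= y ->
  prim f y - prim f x = \int[nu]_t (f t * \1_(`]x, y]) t).
Proof.
move=> fi xy; rewrite !prim_indic -RintegralB//; [|exact: integrable_indic|exact: integrable_indic].
apply: eq_Rintegral => t _; rewrite -mulrBr; congr (_ * _).
rewrite !indicE !mem_setE !in_itv/=.
by case: (leP t x) => tx; case: (leP t y) => ty /=; rewrite ?subrr ?subr0//; lra.
Qed.

(** Turns a pointwise bound on integrands into the integral inequality that [gronwall] requires, on
    either side of the base point. *)
Lemma prim_diff_le (f g : R -> R) (K x y : R) : 0 <= K ->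
  nu.-integrable setT (EFin \o f) -> nu.-integrable setT (EFin \o g) ->
  {ae nu, forall t, `|f t| <= K * g t} ->
  `|prim f y - prim f x| <= K * `|prim g y - prim g x|.
Proof.
move=> K0 fi gi fg.
wlog xy : x y / x <= y.
  move=> H; have [xy|yx] := leP x y; first exact: H.
  by rewrite distrC [X in _ <= _ * X]distrC H// ltW.
rewrite !prim_diff//.
have fI := @integrable_indic f `]x, y] (measurable_itv _) fi.
have gI := @integrable_indic g `]x, y] (measurable_itv _) gi.
apply: le_trans (le_normr_Rintegral _ fI) _ => //.
have KgI : nu.-integrable setT (EFin \o (fun t => K * (g t * \1_(`]x, y]) t))).
  by have := integrableZl measurableT K gI.
apply: (@le_trans _ _ (\int[nu]_t (K * (g t * \1_(`]x, y]) t)))).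
  apply: ae_le_Rintegral => //; first exact: (integrable_norm fI).
  apply: filterS fg => t ft; rewrite normrM mulrA.
  by rewrite indicE; case: (t \in _); rewrite ?normr1 ?normr0 ?mulr1 ?mulr0.
by rewrite RintegralZl// ler_wpM2l// ler_norm.
Qed.

(** Cauchy-Schwarz against the indicator of []x, y]], whose norm is at most the square root of
    [y - x]. This Hölder bound gives continuity, and later the estimate between grid points. *)
Lemma prim_sqrt_le (f : X) (x y : R) : x <= y ->
  `|prim f y - prim f x| <= `|f| * Num.sqrt (y - x).
Proof.
move=> xy; rewrite prim_diff//; last exact: L2_integrable.
have mI : measurable (`]x, y]%classic : set (measurableTypeR R)) by exact: measurable_itv.
have m1 : measurable_fun (setT : set (measurableTypeR R)) (\1_(`]x, y]) : R -> R).
  exact: measurable_indic.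
have L1 : (\1_(`]x, y]) : R -> R) \in Lfun nu 2%:E.
  apply: (@Lfun_bounded _ _ _ 1) => // t.
  by rewrite indicE; case: (t \in _); rewrite ?normr1 ?normr0.
rewrite -L2_inner_class//; apply: le_trans (L2_cauchy_schwarz _ _) _.
rewrite ler_wpM2l// -[leLHS]ger0_norm// -sqrtr_sqr ler_wsqrtr//.
rewrite -L2_inner_self L2_inner_class//.
have -> : \int[nu]_t (L2_class nu \1_(`]x, y]) t * \1_(`]x, y]) t) = \int[nu]_t (\1_(`]x, y]) t).
  apply: ae_eq_Rintegral => //; first exact: measurable_funM.
  apply: filterS (L2_classE L1) => t ->.
  by rewrite indicE; case: (t \in _); rewrite ?mulr1 ?mulr0.
rewrite /Rintegral integral_indic// setIT -lee_fin fineK; last first.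
  rewrite ge0_fin_numE//; apply: le_lt_trans (leb_I_le l mI) _.
  by rewrite /= lebesgue_measure_itv/=; case: ifP => _; rewrite -?EFinB ltry.
apply: le_trans (leb_I_le l mI) _; rewrite /= lebesgue_measure_itv/=.
by case: ifP => _; rewrite -?EFinB// lee_fin subr_ge0.
Qed.

Lemma prim_continuous (f : X) : continuous (prim f).
Proof.
move=> x; apply/subr_cvg0; apply: norm_cvg0.
have H : `|f| * Num.sqrt `|y - x| @[y --> x] --> 0.
  rewrite -[X in _ --> X](mulr0 `|f|) -[in X in _ --> X](@sqrtr0 R).
  rewrite -[in X in _ --> X](normr0 R) -[in X in _ --> X](subrr x).
  apply: cvgM; first exact: cvg_cst.
  apply: continuous_cvg; first exact: sqrt_continuous.
  by apply: cvg_norm; apply: cvgB; [exact: cvg_id|exact: cvg_cst].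
apply: squeeze_cvgr (cvg_cst 0) H; apply: nearW => y; rewrite normr_ge0/=.
have [xy|yx] := leP x y; first by rewrite (ger0_norm (x := y - x)) ?subr_ge0// prim_sqrt_le.
rewrite distrC (distrC y) (ger0_norm (x := x - y)) ?subr_ge0; last exact: ltW.
by rewrite prim_sqrt_le// ltW.
Qed.

Lemma countable_ae (A : set R) : countable A -> {ae nu, forall x, ~ A x}.
Proof.
move=> cA; apply/ae_leb_I; exists A; split.
- by apply: countable_measurable => // t; exact: measurable_set1.
- exact: countable_lebesgue_measure0.
- by move=> x /= /not_implyP[_ /contrapT].
Qed.

(* All but countably many points of a set are limit points of it, and the difference
   quotients of the representative of [u] along its zeros vanish. *)
Lemma weak_deriv_eq0_on (u v : X) (E : set R) : weak_deriv u v ->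
  {ae nu, forall x, E x -> u x = 0} -> {ae nu, forall x, E x -> v x = 0}.
Proof.
move=> uv u0; have [c uc] := weak_deriv_prim uv.
(* The zeros in [E] of the continuous representative of [u]; they make up almost all of [E]. *)
pose Z := [set x | E x /\ c + prim v x = 0].
apply: filter_app u0; apply: filter_app uc.
apply: filterS2 (countable_ae (countable_isolated Z)) (prim_derive_ae (L2_integrable v)).
move=> x niso dx uE u0 Ex.
have Zx : Z x by split=> //; rewrite -uE u0.
have /limit_pointP[a_ [a_Z a_x a_cvg]] : limit_point Z x.
  by have := subset_closure Zx; rewrite closure_isolated_limit_point => -[].
have h0 n : a_ n - x != 0 by rewrite subr_eq0.
have hc : a_ n - x @[n --> \oo] --> 0 by rewrite -(subrr x); apply: cvgB => //; exact: cvg_cst.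
have := cvg_difference_quotient dx h0 hc.
move=> /(cvg_lim (@Rhausdorff R)) <-; apply/cvg_lim => //.
apply: cvg_near_cst; apply: nearW => n.
have [_ pa] : Z (a_ n) by apply: a_Z; exists n.
have [_ px] := Zx.
have -> : x + (a_ n - x) = a_ n by ring.
have -> : prim v (a_ n) = prim v x by lra.
by rewrite subrr mul0r.
Qed.

Lemma unique_continuation (u : X) (K : R) (E : set R) : H2 u ->
  {ae nu, forall x, `|Dx (Dx u) x| <= K * `|u x|} ->
  {ae nu, forall x, E x -> u x = 0} -> ~ nu.-negligible E -> u = 0.
Proof.
move=> [/H1_weak_deriv hu /H1_weak_deriv hdu] uK u0 En.
have {hu}hu := hu l_gt0; have {hdu}hdu := hdu l_gt0.
have du0 := weak_deriv_eq0_on hu u0.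
have [c uc] := weak_deriv_prim hu; have [d dud] := weak_deriv_prim hdu.
pose U x := c + prim (Dx u) x; pose P x := d + prim (Dx (Dx u)) x.
(* Almost every point of [E] is a common zero of [U] and [P] in [I]; if there were none, [E] would
   be negligible. *)
have [x0 [Ix0 Ux0 Px0]] : exists x0, [/\ I x0, U x0 = 0 & P x0 = 0].
  apply: contrapT => nx0; apply: En.
  have : {ae nu, forall x, ~ E x}.
    apply: filter_app uc; apply: filter_app dud; apply: filter_app u0.
    apply: filterS2 (ae_in_I l) du0 => x Ix du u0 dP uU Ex.
    by apply: nx0; exists x; split; [exact: Ix|rewrite /U -uU u0|rewrite /P -dP du].
  by apply: negligibleS => x Ex /=; apply.
have cU : continuous U by move=> x; apply: cvgD; [exact: cvg_cst|exact: prim_continuous].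
have cP : continuous P by move=> x; apply: cvgD; [exact: cvg_cst|exact: prim_continuous].
pose m x := `|U x| + `|P x|.
have cm : continuous m by move=> x; apply: cvgD; apply: cvg_norm; [exact: cU|exact: cP].
have mi : nu.-integrable setT (EFin \o m).
  apply/Lfun1_integrable; apply: (Lfun_subset12 (leb_I_setT_fin l)).
  exact: Lfun_continuous.
have K0 : 0 <= `|K| by [].
have m_eq0 : forall x, x \in `]0, l[ -> m x = 0.
  (* The increments of [U] are bounded through [U' = P], which gives the 1, and those of [P] through
     [|P'| <= |K| |U|]. *)
  apply: (@gronwall _ m (prim m) (1 + `|K|) _ _ x0).
  - by rewrite addr_ge0.
  - exact: Ix0.
  - by move=> x xI; apply: prim_derive => //; exact: cm.
  - by move=> x _; rewrite addr_ge0.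
  - move=> x xI; rewrite mulrDl; apply: lerD.
      have -> : U x = prim (Dx u) x - prim (Dx u) x0 by move: Ux0; rewrite /U; lra.
      apply: prim_diff_le => //; first exact: L2_integrable.
      by apply: filterS dud => t ->; rewrite mul1r lerDr.
    have -> : P x = prim (Dx (Dx u)) x - prim (Dx (Dx u)) x0 by move: Px0; rewrite /P; lra.
    apply: prim_diff_le => //; first exact: L2_integrable.
    apply: filterS2 uK uc => t ut uU; apply: le_trans ut _; rewrite uU -/(U t).
    apply: (@le_trans _ _ (`|K| * `|U t|)); first by rewrite ler_wpM2r// ler_norm.
    by rewrite ler_wpM2l// lerDl.
apply: eqL2; apply: filterS3 (ae_in_I l) uc (L2_fun0 nu) => x Ix uU ->.
have xI : x \in `]0, l[ by exact: Ix.
have Ule : `|U x| <= m x by rewrite /m lerDl.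
have Ux : U x = 0.
  by apply/normr0_eq0/eqP; rewrite eq_le normr_ge0 andbT -(m_eq0 x xI).
rewrite uU.
exact: Ux.
Qed.

End unique_continuation.

(** * Eigenfunctions *)

Section eigenfunctions.
Context {R : realType}.
Variables (l eps1 rho : R) (alpha1 : R -> R).
Hypothesis l_gt0 : 0 < l.
Hypothesis eps1_gt0 : 0 < eps1.
Hypothesis alpha1_Loo : alpha1 \in Lfun (leb_I l) +oo%E.
Local Notation nu := (leb_I l).
Local Notation I := (Iset l).
Local Notation X := (L2 nu).
Local Notation D := (@D_An R l).
Local Notation A := (@An R l eps1 alpha1).

Lemma An_lin (a : R) (u v : X) : D u -> D v ->
  D (a *: u + v) /\ A (a *: u + v) = a *: A u + A v.
Proof.
move=> [u2 u0] [v2 v0]; have [H E] := H2_lin l_gt0 a u2 v2.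
split; first by split; [exact: H|exact: H10_lin].
rewrite /An E mulopD// mulopZ// !scalerDr !scalerA (mulrC eps1 a).
by rewrite !addrA; congr (_ + _); rewrite -!addrA; congr (_ + _); rewrite addrC.
Qed.

Lemma An0 : D 0 /\ A 0 = 0.
Proof.
have [h e] := H1_0 l_gt0; split.
  by split; [split; rewrite ?e|exact: H10_0].
have m0 : mulop alpha1 (0 : X) = 0.
  by have := mulopZ alpha1_Loo 0 (0 : X); rewrite !scale0r.
by rewrite /An !e scaler0 add0r m0.
Qed.

Lemma AnZ (a : R) (u : X) : D u -> D (a *: u) /\ A (a *: u) = a *: A u.
Proof.
move=> Du; have [D0 A0] := An0; have := An_lin a Du D0.
by rewrite A0 !addr0.
Qed.

Lemma An_sum (T : eqType) (s : seq T) (q : T -> X) : (forall i, i \in s -> D (q i)) ->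
  D (\sum_(i <- s) q i) /\ A (\sum_(i <- s) q i) = \sum_(i <- s) A (q i).
Proof.
elim: s => [_|i s IH H]; first by rewrite !big_nil; exact: An0.
have [|D1 E1] := IH; first by move=> j js; apply: H; rewrite inE js orbT.
have Di : D (q i) by apply: H; rewrite inE eqxx.
have := An_lin 1 Di D1; rewrite !scale1r => -[D2 E2].
by rewrite !big_cons E2 E1.
Qed.

(** The boundary terms vanish because [v] is in H^1_0. The resulting form is symmetric, and its
    first term controls [Dx u]. *)
Lemma inner_An (u v : X) : D u -> D v ->
  L2_inner (A u) v = - eps1 * L2_inner (Dx u) (Dx v) + L2_inner (mulop alpha1 u) v.
Proof.
move=> [[u1 u2] _] [_ v0]; rewrite /An L2_innerDl L2_innerZl.
by rewrite integration_by_parts_H10// mulrN mulNr.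
Qed.

Lemma An_sym (u v : X) : D u -> D v -> L2_inner (A u) v = L2_inner u (A v).
Proof.
move=> Du Dv; rewrite (L2_innerC u) !inner_An// (L2_innerC (Dx v)).
by rewrite mulop_sym// (L2_innerC u).
Qed.

(** The vector may be 0, unlike in [eigenvector_An], so that eigenpairs are stable under scaling by
    any real number. *)
Definition eigenpair (p : R * X) : Prop :=
  [/\ - rho < p.1, D p.2 & A p.2 = p.1 *: p.2].

Lemma eigenpair_orth (p q : R * X) : eigenpair p -> eigenpair q ->
  p.1 != q.1 -> L2_inner p.2 q.2 = 0.
Proof.
move=> [_ Dp Ap] [_ Dq Aq] pq.
have := An_sym Dp Dq; rewrite Ap Aq L2_innerZl L2_innerZr => /eqP.
by rewrite -subr_eq0 -mulrBl mulf_eq0 subr_eq0 (negbTE pq) => /eqP.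
Qed.

Lemma eigenpair_form_ge (s : seq (R * X)) (u : X) :
  (forall p, p \in s -> eigenpair p) -> u = \sum_(p <- s) p.2 ->
  - rho * `|u| ^+ 2 <= L2_inner (A u) u.
Proof.
move=> es uE; have Ds p : p \in s -> D p.2 by move=> /es[].
have [Du Au] := An_sum Ds; rewrite -uE in Du Au.
rewrite -L2_inner_self -subr_ge0 mulNr opprK -L2_innerZl -L2_innerDl.
(* [(p.1 + rho) <p.2, q.2> = <sqrt (p.1 + rho) p.2, sqrt (q.1 + rho) q.2>], as
   [<p.2, q.2> = 0] unless [p.1 = q.1]; so the form is a squared norm. *)
have -> : A u + rho *: u = \sum_(p <- s) (p.1 + rho) *: p.2.
  rewrite Au uE scaler_sumr -big_split; apply: eq_big_seq => p /es[_ _ ->] /=.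
  by rewrite scalerDl.
pose w := \sum_(p <- s) Num.sqrt (p.1 + rho) *: p.2.
suff -> : L2_inner (\sum_(p <- s) (p.1 + rho) *: p.2) u = L2_inner w w.
  by rewrite L2_inner_self sqr_ge0.
rewrite /w uE !L2_inner_suml; apply: eq_big_seq => p ps.
rewrite !L2_inner_sumr; apply: eq_big_seq => q qs.
rewrite !L2_innerZl L2_innerZr.
have [pq|pq] := eqVneq p.1 q.1; last first.
  by rewrite (eigenpair_orth (es _ ps) (es _ qs) pq) !mulr0.
have [p0 _ _] := es _ ps.
by rewrite mulrA -pq -expr2 sqr_sqrtr//; lra.
Qed.

(** Combines [- rho |u|^2 <= <A u, u>] with [<A u, u> <= - eps1 |u'|^2 + C |u|^2]. The constant is
    uniform in [s], which is what finite dimension rests on. *)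
Lemma eigenpair_energy : exists2 C : R, 0 <= C & 
  forall (s : seq (R * X)) (u : X), (forall p, p \in s -> eigenpair p) ->
  u = \sum_(p <- s) p.2 -> `|Dx u| ^+ 2 <= C * `|u| ^+ 2.
Proof.
have [C C0 aC] := inner_mulop_le alpha1_Loo.
exists ((C + `|rho|) / eps1); first by rewrite divr_ge0 ?addr_ge0// ltW.
move=> s u es uE; have Ds p : p \in s -> D p.2 by move=> /es[].
have [Du Au] := An_sum Ds; rewrite -uE in Du Au.
have := eigenpair_form_ge es uE; rewrite inner_An// L2_inner_self => H.
rewrite mulrAC ler_pdivlMr// mulrC.
have := aC u; have := ler_wpM2r (sqr_ge0 `|u|) (ler_norm rho).
lra.
Qed.

Lemma eigenpair_sum_eq0 (E : set R) (s : seq (R * X)) : ~ nu.-negligible E ->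
  (forall p, p \in s -> eigenpair p) ->
  {ae nu, forall x, E x -> (\sum_(p <- s) p.2 : X) x = 0} ->
  \sum_(p <- s) p.2 = 0.
Proof.
move=> En.
(* Induction on a bound for the number of summands, as the shorter sum runs over a new list. *)
have [k] := ubnP (size s); elim: k s => // k IH [|p s] /= sk es u0.
  by rewrite big_nil.
have ep : eigenpair p by apply: es; rewrite inE eqxx.
have es' q : q \in s -> eigenpair q by move=> qs; apply: es; rewrite inE qs orbT.
set u := \sum_(q <- _) _ in u0 *.
have Ds q : q \in p :: s -> D q.2 by move=> /es[].
have [Du Au] := An_sum Ds; rewrite -/u in Du Au.
have [[/(H1_weak_deriv l_gt0) h1 /(H1_weak_deriv l_gt0) h2] _] := Du.
have du0 := weak_deriv_eq0_on h1 u0; have ddu0 := weak_deriv_eq0_on h2 du0.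
(* Applying [A - p.1] cancels the head and rescales each other vector, possibly to 0. *)
pose s' := [seq (q.1, (q.1 - p.1) *: q.2) | q <- s].
have E' : A u - p.1 *: u = \sum_(q <- s') q.2.
  rewrite Au /u big_map !big_cons /= scalerDr opprD addrACA.
  have [_ _ ->] := ep; rewrite subrr add0r scaler_sumr -sumrB.
  by apply: eq_big_seq => q /es'[_ _ ->] /=; rewrite scalerBl.
have Apu : A u = p.1 *: u.
  apply/eqP; rewrite -subr_eq0 E'; apply/eqP; apply: IH.
  - by rewrite size_map -ltnS.
  - move=> _ /mapP[q qs ->]; have [q1 q2 q3] := es' q qs.
    have [Dq Aq] := AnZ (q.1 - p.1) q2.
    by split=> //=; rewrite Aq q3 !scalerA mulrC.
  (* On [E] the functions [u], [alpha1 u] and [u''] all vanish almost everywhere. *)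
  - rewrite -E' /An.
    apply: filter_app (L2_funD (eps1 *: Dx (Dx u) + mulop alpha1 u) (- (p.1 *: u))).
    apply: filter_app (L2_funD (eps1 *: Dx (Dx u)) (mulop alpha1 u)).
    rewrite -scaleNr; apply: filter_app (L2_funZ (- p.1) u).
    apply: filter_app (mulopE alpha1_Loo u).
    apply: filterS3 (L2_funZ eps1 (Dx (Dx u))) u0 ddu0 => x e1 e2 e3 e4 e5 e6 e7 Ex.
    by rewrite e7 e6 e5 e4 e1 e2// e3// !mulr0 !addr0.
have [C [C0 aC]] := Lfun_oo_bounded alpha1_Loo.
(* The constant comes from [eps1 u'' = (p.1 - alpha1) u] and [|alpha1| <= C]. *)
apply: (@unique_continuation R l l_gt0 u ((`|p.1| + C) / eps1) E) => //.
  by case: Du.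
have ddE : Dx (Dx u) = eps1^-1 *: (p.1 *: u - mulop alpha1 u).
  by rewrite -Apu /An addrK scalerA mulVf ?gt_eqF// scale1r.
rewrite ddE.
apply: filter_app (L2_funZ eps1^-1 (p.1 *: u - mulop alpha1 u)).
rewrite -scaleN1r.
apply: filter_app (L2_funD (p.1 *: u) (-1 *: mulop alpha1 u)).
apply: filter_app (L2_funZ (-1) (mulop alpha1 u)).
apply: filterS3 (L2_funZ p.1 u) (mulopE alpha1_Loo u) aC => x e1 e2 e3 e4 e5 e6.
rewrite e6 e5 e4 e2 e1 normrM gtr0_norm ?invr_gt0// [leRHS]mulrAC [leRHS]mulrC.
rewrite ler_wpM2l ?invr_ge0 ?(ltW eps1_gt0)// mulN1r mulrDl.
by apply: le_trans (ler_normB _ _) _; rewrite !normrM lerD// ler_wpM2r.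
Qed.

End eigenfunctions.

(** * Finite dimension *)

Section finite_dimension.
Context {R : realType}.
Variable l : R.
Hypothesis l_gt0 : 0 < l.
Local Notation nu := (leb_I l).
Local Notation I := (Iset l).
Local Notation X := (L2 nu).
Local Notation prim := (@prim R l).

Lemma L2_norm_le_ae (u : X) (e : R) : {ae nu, forall x, `|u x| <= e} ->
  `|u| ^+ 2 <= e ^+ 2 * l.
Proof.
move=> ue.
have nul : fine (nu setT) = l.
  by rewrite /leb_I/= /mrestr setTI /Iset lebesgue_measure_itv/= lte_fin l_gt0/= subr0.
rewrite -L2_inner_self -[in leRHS]nul -(Rintegral_cst nu measurableT (e ^+ 2)).
apply: ae_le_Rintegral; [exact: L2_integrableM| |].
  apply/Lfun1_integrable; apply: (Lfun_subset12 (leb_I_setT_fin l)).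
  exact: (@Lfun_bounded _ _ (cst (e ^+ 2)) `|e ^+ 2| (measurable_cst _) (fun=> lexx _)).
apply: filterS ue => x ux; rewrite -expr2 -[leLHS]ger0_norm ?sqr_ge0// normrX.
by rewrite ler_sqr ?nnegrE//; apply: le_trans ux.
Qed.

Lemma prim_lin (a : R) (f g : X) (x : R) :
  prim (a *: f + g : X) x = a * prim f x + prim g x.
Proof.
have L1 : (\1_(`]-oo, x]) : R -> R) \in Lfun nu 2%:E.
  apply: (@Lfun_bounded _ _ _ 1); last first.
    by move=> t; rewrite indicE; case: (t \in _); rewrite ?normr1 ?normr0.
  by apply: measurable_indic; exact: measurable_itv.
by rewrite !prim_indic -!L2_inner_class// L2_innerDl L2_innerZl.
Qed.

(* [c] is the value at 0 of the continuous representative of [u]. *)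
Definition primitive_of_Dx (u : X) (c : R) : Prop :=
  H1 u /\ {ae nu, forall x, u x = c + prim (Dx u) x}.

Lemma primitive_of_Dx_ex (u : X) : H1 u -> exists c, primitive_of_Dx u c.
Proof.
move=> hu; have [c uc] := weak_deriv_prim (H1_weak_deriv l_gt0 hu).
by exists c; split; [exact: hu|exact: uc].
Qed.

(** Point values of the continuous representative are linear in the coefficients, so vanishing at
    finitely many points is a linear system. *)
Lemma primitive_of_Dx_sum (T : Type) (s : seq T) (a c : T -> R) (v : T -> X) :
  (forall i, primitive_of_Dx (v i) (c i)) ->
  primitive_of_Dx (\sum_(i <- s) a i *: v i) (\sum_(i <- s) a i * c i) /\
  forall x, prim (Dx (\sum_(i <- s) a i *: v i : X) : X) x =
    \sum_(i <- s) a i * prim (Dx (v i)) x.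
Proof.
move=> vc; elim: s => [|i s [[IH1 IH2] IH3]].
  have [h0 d0] := H1_0 l_gt0.
  have p0 x : prim (0 : X) x = 0.
    by have := prim_lin (-1) (0 : X) 0 x; rewrite scaler0 addr0 mulN1r addNr.
  split; last by move=> x; rewrite !big_nil d0 p0.
  rewrite !big_nil; split; first exact: h0.
  by rewrite d0; apply: filterS (L2_fun0 nu) => x ->; rewrite p0 addr0.
have [hv vE] := vc i; have [h dE] := H1_lin l_gt0 (a i) hv IH1.
have pE x : prim (Dx (\sum_(j <- i :: s) a j *: v j : X) : X) x =
    \sum_(j <- i :: s) a j * prim (Dx (v j)) x.
  by rewrite !big_cons dE prim_lin IH3.
split; last exact: pE.
split; first by rewrite big_cons; exact: h.
rewrite !big_cons dE.
apply: filter_app (L2_funD (a i *: v i) (\sum_(j <- s) a j *: v j)).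
apply: filterS3 (L2_funZ (a i) (v i)) vE IH2 => x e1 e2 e3 ->.
by rewrite e1 e2 e3 prim_lin mulrDr addrACA.
Qed.

Lemma L2_dependent (C : R) : 0 <= C -> exists N : nat, forall n (v : 'I_n -> X),
  (N < n)%N -> (forall i, H1 (v i)) ->
  (forall c : 'I_n -> R, `|Dx (\sum_i c i *: v i)| ^+ 2 <= C * `|\sum_i c i *: v i| ^+ 2) ->
  exists c : 'I_n -> R, (exists i, c i != 0) /\ \sum_i c i *: v i = 0.
Proof.
(* Makes [l^2 C / N < 1], the contraction factor obtained at the end. *)
move=> C0; pose N := (Num.truncn (l * l * C)).+1; exists N => n v Nn v1 vC.
have NC : l * l * C < N%:R.
  by have /andP[_] := Num.Theory.truncn_itv (mulr_ge0 (mulr_ge0 (ltW l_gt0) (ltW l_gt0)) C0).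
have N0 : 0 < N%:R :> R by rewrite ltr0n.
pose h := l / N%:R; have h0 : 0 < h by rewrite divr_gt0.
have [d vd] := choice (fun i => primitive_of_Dx_ex (v1 i)).
pose F := \matrix_(i < n, j < N) (d i + prim (Dx (v i)) (j%:R * h)).
(* With more vectors than grid points, some nontrivial combination vanishes at all grid points. *)
have /rowV0Pn[a /sub_kermxP aF a0] : kermx F != 0.
  rewrite -mxrank_eq0 mxrank_ker subn_eq0 -ltnNge.
  exact: leq_ltn_trans (rank_leq_col F) Nn.
have [k ak] : exists k, a 0 k != 0.
  by move/rV0Pn : a0.
exists (a 0); split; first by exists k.
have [[u1 uE] dE] := @primitive_of_Dx_sum _ (index_enum 'I_n) (a 0) d v vd.
set u : X := \sum_i a 0 i *: v i in u1 uE dE *.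
pose U x := \sum_i a 0 i * d i + prim (Dx u) x.
have Uj (j : 'I_N) : U (j%:R * h) = 0.
  have := congr1 (fun M : 'rV_N => M 0 j) aF; rewrite !mxE => <-.
  rewrite /U dE -big_split; apply: eq_bigr => i _.
  by rewrite mxE mulrDr.
have Ub : {ae nu, forall x, `|u x| <= `|Dx u| * Num.sqrt h}.
  apply: filterS2 (ae_in_I l) uE => x; rewrite /Iset/= in_itv/= => /andP[x0 xl] ->.
  have xh : 0 <= x / h by rewrite divr_ge0 ?ltW.
  (* The truncation of [x / h] indexes the last grid point at or before [x], at distance at most
     [h]. *)
  have /andP[j1 j2] := Num.Theory.truncn_itv xh.
  have jN : (Num.truncn (x / h) < N)%N.
    rewrite -(ltr_nat R); apply: le_lt_trans j1 _.
    by rewrite ltr_pdivrMr// /h mulrC divfK ?gt_eqF.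
  have xj : (Num.truncn (x / h))%:R * h <= x by rewrite -ler_pdivlMr.
  have -> : \sum_i a 0 i * d i + prim (Dx u) x =
      prim (Dx u) x - prim (Dx u) ((Num.truncn (x / h))%:R * h).
    by have := Uj (Ordinal jN); rewrite /U/=; lra.
  apply: le_trans (prim_sqrt_le _ xj) _; rewrite ler_wpM2l// ler_wsqrtr//.
  rewrite lerBlDr.
  by move: j2; rewrite ltr_pdivrMr// -natr1 mulrDl mul1r addrC => /ltW.
have := L2_norm_le_ae Ub; rewrite exprMn (sqr_sqrtr (ltW h0)) => H.
have {}H : `|u| ^+ 2 <= (l * l * C / N%:R) * `|u| ^+ 2.
  apply: le_trans H _.
  have := vC (a 0); rewrite -/u => /(ler_wpM2r (ltW (mulr_gt0 h0 l_gt0))).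
  rewrite mulrA => /le_trans; apply; rewrite /h le_eqVlt; apply/orP; left; apply/eqP.
  by field; rewrite gt_eqF.
have q1 : l * l * C / N%:R < 1 by rewrite ltr_pdivrMr// mul1r.
apply/normr0_eq0/eqP; rewrite -sqrf_eq0 eq_le sqr_ge0 andbT.
by have := sqr_ge0 `|u|; nra.
Qed.

End finite_dimension.

(** * Linear systems *)

Section linear_systems.
Context {R : realType}.

Lemma is_derive_scale (V : normedModType R) (t : R) (a b : V) :
  is_derive t (1 : R) (fun s => a + s *: b) b.
Proof.
suff cv : (fun h : R => h^-1 *: ((a + (h *: 1 + t) *: b) - (a + t *: b))) @ (0 : R)^' --> b.
  by split; [apply/cvg_ex; exists b|apply/cvg_lim => //; exact: norm_hausdorff].
apply: cvg_near_cst; near=> h; have h0 : h != 0 by near: h; exact: nbhs_dnbhs_neq.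
by rewrite opprD addrACA subrr add0r -scalerBl addrK [h *: 1]mulr1 scalerA mulVf ?scale1r.
Unshelve. all: by end_near. Qed.

Lemma affine_continuous (V : normedModType R) (a b : V) :
  continuous (fun s : R => a + s *: b).
Proof. by move=> s; apply: cvgD; [exact: cvg_cst|apply: cvgZr_tmp; exact: cvg_id]. Qed.

Lemma controllable_right_inverse (V W : normedModType R) (A : {linear V -> V})
    (B : W -> V) (S : {linear V -> W}) : (forall v, B (S v) = v) -> controllable A B.
Proof.
move=> BS t1 q0 q1 t1_gt0; pose a := t1^-1 *: (q1 - q0).
(* This input is [S (a - A (q t))] expanded along the segment; being affine in [t], it is
   continuous. *)
exists (fun t => S (a - A q0) + t *: S (- A a)), (fun t => q0 + t *: a); split.
- by apply: continuous_subspaceT; exact: affine_continuous.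
- by apply: continuous_subspaceT; exact: affine_continuous.
- move=> t _.
  have -> : S (a - A q0) + t *: S (- A a) = S ((a - A q0) + t *: (- A a)).
    by rewrite [RHS]linearD [in RHS]linearZ.
  rewrite BS linearD linearZ scalerN.
  rewrite addrACA subrr addr0 addrC subrK.
  exact: is_derive_scale.
- by rewrite scale0r addr0.
- by rewrite scalerA mulfV ?gt_eqF// scale1r addrC subrK.
Qed.

(** An eigenvector for [a + ib] is annihilated by [(a + 1) + ib], hence by its squared modulus, a
    real scalar acting separately on [u] and [v]; so [a = -1]. *)
Lemma hurwitz_opp (V : normedModType R) : hurwitz (fun v : V => - v).
Proof.
move=> a b [u [v [uv Eu Ev]]].
have {}Eu : (a + 1) *: u = b *: v.
  by rewrite scalerDl scale1r -[X in _ + X](opprK u) Eu opprB addrC subrK.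
have {}Ev : (a + 1) *: v = - (b *: u).
  by rewrite scalerDl scale1r -[X in _ + X](opprK v) Ev opprD addrCA subrr addr0.
have D : 0 <= (a + 1) ^+ 2 + b ^+ 2 by rewrite addr_ge0 ?sqr_ge0.
have Du : ((a + 1) ^+ 2 + b ^+ 2) *: u = 0.
  by rewrite scalerDl expr2 -scalerA Eu scalerA mulrC -scalerA Ev scalerN scalerA -expr2 addNr.
have Dv : ((a + 1) ^+ 2 + b ^+ 2) *: v = 0.
  by rewrite scalerDl expr2 -scalerA Ev scalerN scalerA mulrC -scalerA Eu scalerA -expr2 addNr.
have /eqP : (a + 1) ^+ 2 + b ^+ 2 == 0.
  case: uv => /negbTE uv.
    by move/eqP : Du; rewrite scaler_eq0 uv orbF.
  by move/eqP : Dv; rewrite scaler_eq0 uv orbF.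
by move=> /eqP; rewrite paddr_eq0 ?sqr_ge0// sqrf_eq0 => /andP[/eqP a1 _]; lra.
Qed.

Lemma exp_op_opp (V : normedModType R) (t : R) (v : V) :
  exp_op (fun v => - v) t v = expR (- t) *: v.
Proof.
rewrite /exp_op; apply/cvg_lim; first exact: norm_hausdorff.
rewrite (_ : series _ = fun n => series (exp_coeff (- t)) n *: v).
  by apply: cvgZr_tmp; exact: is_cvg_series_exp_coeff.
apply/funext => n; rewrite /series/= scaler_suml; apply: eq_bigr => k _.
have -> : iter k (fun v : V => - v) v = (-1) ^+ k *: v.
  by elim: k => [|k IH]; rewrite ?expr0 ?scale1r//= IH exprS -scalerA scaleN1r.
by rewrite scalerA /exp_coeff/= -[in RHS]mulN1r exprMn mulrC mulrA.
Qed.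

Lemma op_norm_le (V W : normedModType R) (S : V -> W) (c : R) :
  (forall v, `|v| <= 1 -> `|S v| <= c) -> (op_norm S <= c%:E)%E.
Proof. by move=> H; apply: ge_ereal_sup => _ [v v1 <-]; rewrite lee_fin H. Qed.

Lemma linear_continuous_of_bound (V W : normedModType R) (K : {linear V -> W}) (C : R) :
  (forall v, `|K v| <= C * `|v|) -> continuous K.
Proof.
move=> KC; apply/linear_bounded_continuous/linear_boundedP.
near=> r => v; apply: le_trans (KC v) _; rewrite ler_wpM2r//.
Unshelve. all: by end_near. Qed.

End linear_systems.

(** * The critical space: invariance, basis, and a right inverse of the input operator *)

Section critical_space.
Context {R : realType}.
Variables (l eps1 rho : R) (alpha1 : R -> R).
Hypothesis l_gt0 : 0 < l.
Hypothesis eps1_gt0 : 0 < eps1.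
Hypothesis alpha1_Loo : alpha1 \in Lfun (leb_I l) +oo%E.
Local Notation nu := (leb_I l).
Local Notation I := (Iset l).
Local Notation X := (L2 nu).
Local Notation D := (@D_An R l).
Local Notation A := (@An R l eps1 alpha1).
Local Notation V := (Xcr l eps1 alpha1 rho).
Local Notation eigenpair := (@eigenpair R l eps1 rho alpha1).
Local Notation G := [set phi : X |
  exists2 lambda, - rho < lambda & eigenvector_An eps1 alpha1 lambda phi].

Lemma lspan_gen (K : set X) (v : X) : K v -> v \in lspan K.
Proof.
move=> Kv; apply/asboolP; exists 1%N, (fun=> 1), (fun=> v).
by split=> //; rewrite big_ord1 scale1r.
Qed.

(** The coefficients are absorbed into the eigenvectors; a zero coefficient is harmless, as
    [eigenpair] admits the zero vector. *)
Lemma lspan_eigenpairs (u : X) : u \in lspan G ->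
  exists s : seq (R * X), (forall p, p \in s -> eigenpair p) /\ u = \sum_(p <- s) p.2.
Proof.
move=> /asboolP[n [c [e [Ge ->]]]].
have /choice[lam lamP] : forall i : 'I_n, exists lam : R,
    - rho < lam /\ eigenvector_An eps1 alpha1 lam (e i).
  by move=> i; have [lam H1 H2] := Ge i; exists lam.
exists [seq (lam i, c i *: e i) | i <- index_enum 'I_n]; split; last by rewrite big_map.
move=> _ /mapP[i _ ->]; have [lami [De _ Ae]] := lamP i.
have [DZ AZ] := AnZ eps1 l_gt0 alpha1_Loo (c i) De.
by split; [exact: lami|exact: DZ|rewrite AZ Ae !scalerA mulrC].
Qed.

Lemma eigenpairs_lspan (s : seq (R * X)) : (forall p, p \in s -> eigenpair p) ->
  \sum_(p <- s) p.2 \in lspan G.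
Proof.
move=> es; rewrite big_seq; apply: rpred_sum => p /es[p1 Dp Ap].
have [->|p0] := eqVneq p.2 0; first exact: rpred0.
by apply: lspan_gen; exists p.1; [exact: p1|split; [exact: Dp|exact: p0|exact: Ap]].
Qed.

Lemma lspan_An (u : X) : u \in lspan G -> D u /\ A u \in lspan G.
Proof.
move=> /lspan_eigenpairs[s [es ->]].
have Ds p : p \in s -> D p.2 by move=> /es[].
have [Du Au] := An_sum eps1 l_gt0 alpha1_Loo Ds; split; first exact: Du.
rewrite Au (_ : \sum_(p <- s) _ = \sum_(p <- [seq (p.1, p.1 *: p.2) | p <- s]) p.2).
  apply: eigenpairs_lspan => _ /mapP[p ps ->]; have [p1 Dp Ap] := es p ps.
  have [DZ AZ] := AnZ eps1 l_gt0 alpha1_Loo p.1 Dp.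
  by split; [exact: p1|exact: DZ|rewrite AZ Ap].
by rewrite big_map; apply: eq_big_seq => p /es[].
Qed.

Lemma Xcr_D (q : V) : D (span_val q).
Proof. by have [] := lspan_An (span_valP q). Qed.

Lemma AcrE (q : V) : span_val (Acr l eps1 alpha1 rho q) = A (span_val q).
Proof. by apply: insubdK; have [] := lspan_An (span_valP q). Qed.

Lemma span_val_linear (a : R) (u v : V) :
  span_val (a *: u + v) = a *: span_val u + span_val v.
Proof. by []. Qed.

Lemma span_val_sum (T : Type) (s : seq T) (q : T -> V) :
  span_val (\sum_(i <- s) q i) = \sum_(i <- s) span_val (q i).
Proof. exact: (raddf_sum (val : V -> X)). Qed.

Lemma Acr_linear : linear (Acr l eps1 alpha1 rho : V -> V).
Proof.
move=> a u v; apply: val_inj; rewrite /= AcrE !span_val_linear.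
have [_ ->] := An_lin eps1 l_gt0 alpha1_Loo a (Xcr_D u) (Xcr_D v).
by rewrite !AcrE.
Qed.

(** The difference of two candidates lies in the critical space and is orthogonal to it, hence to
    itself. *)
Lemma PcrE (f : X) (p : V) :
  (forall y : V, L2_inner (f - span_val p) (span_val y) = 0) -> Pcr f = p.
Proof.
move=> fp; rewrite /Pcr; case: xgetP => [p' _ fp'|/(_ p)/(_ fp)//].
apply: val_inj; rewrite /=; apply/eqP; rewrite -subr_eq0; apply/eqP/L2_inner_self_eq0.
have -> : L2_inner (span_val p' - span_val p) (span_val p' - span_val p) =
    L2_inner ((f - span_val p) - (f - span_val p')) (span_val (p' - p)).
  rewrite -[span_val (p' - p)]/(span_val p' - span_val p); congr (L2_inner _ _).
  by rewrite opprB [RHS]addrC subrKA.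
by rewrite L2_innerBl fp fp' subrr.
Qed.

Lemma Xcr_energy : exists2 C : R, 0 <= C &
  forall q : V, `|Dx (span_val q)| ^+ 2 <= C * `|span_val q| ^+ 2.
Proof.
have [C C0 H] := eigenpair_energy rho l_gt0 eps1_gt0 alpha1_Loo.
exists C => // q; have [s [es qE]] := lspan_eigenpairs (span_valP q).
exact: H es qE.
Qed.

Lemma Xcr_eq0 (E : set R) (q : V) : ~ nu.-negligible E ->
  {ae nu, forall x, E x -> (span_val q : X) x = 0} -> q = 0.
Proof.
move=> En qE; have [s [es sE]] := lspan_eigenpairs (span_valP q).
apply: val_inj; rewrite /= sE; rewrite sE in qE.
exact: eigenpair_sum_eq0 En es qE.
Qed.

Definition lin_indep n (e : 'I_n -> V) : Prop :=
  forall c : 'I_n -> R, \sum_i c i *: e i = 0 -> forall i, c i = 0.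

Lemma lin_indep_bound : exists N : nat, forall n (e : 'I_n -> V), lin_indep e -> (n <= N)%N.
Proof.
have [C C0 H] := Xcr_energy; have [N HN] := L2_dependent l_gt0 C0.
exists N => n e ei; rewrite leqNgt; apply/negP => Nn.
have sE (c : 'I_n -> R) : span_val (\sum_i c i *: e i) = \sum_i c i *: span_val (e i).
  by rewrite span_val_sum.
have [||c [[i ci] cE]] := HN n (fun i => span_val (e i)) Nn.
- by move=> i; have [[]] := Xcr_D (e i).
- by move=> c; rewrite -sE; exact: H.
by move: ci; rewrite (ei c) ?eqxx//; apply: val_inj; rewrite /= sE cE.
Qed.

(** A linearly independent family of maximal size, which exists by [lin_indep_bound], is
    spanning. *)
Lemma Xcr_basis : exists n (e : 'I_n -> V), lin_indep e /\
  forall q, exists c : 'I_n -> R, q = \sum_i c i *: e i.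
Proof.
have [N HN] := lin_indep_bound.
pose P n := `[< exists e : 'I_n -> V, lin_indep e >].
have P0 : exists n, P n.
  by exists 0%N; apply/asboolP; exists (fun=> 0) => c _ [].
have PN n : P n -> (n <= N)%N by move=> /asboolP[e /HN].
case: (ex_maxnP P0 PN) => n /asboolP[e ei] nmax.
exists n, e; split=> // q.
pose f (i : 'I_n.+1) := if unlift ord_max i is Some j then e j else q.
have /asboolPn/forallNP/(_ f) : ~~ P n.+1.
  by apply/negP => /nmax; rewrite ltnn.
move=> /existsNP[c] /not_implyP[c0] /existsNP[i /eqP ci].
have fE (i0 : 'I_n) : f (widen_ord (leqnSn n) i0) = e i0.
  rewrite /f (_ : widen_ord _ i0 = lift ord_max i0) ?liftK//.
  by apply: val_inj; rewrite /= /bump leqNgt ltn_ord.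
have fq : f ord_max = q by rewrite /f unlift_none.
move: c0; rewrite big_ord_recr/= fq.
under eq_bigr do rewrite fE.
move=> /eqP; rewrite addrC addr_eq0 => /eqP cq.
(* If the coefficient of the appended vector [q] is 0, the relation involves only the [e i] and is
   trivial; otherwise it is solved for [q]. *)
have [cm|cm] := eqVneq (c ord_max) 0.
  exfalso; move: cq; rewrite cm scale0r => /esym/eqP; rewrite oppr_eq0 => /eqP /ei H.
  move/negP : ci; apply; apply/eqP.
  have [j ->|->] := unliftP ord_max i; last exact: cm.
  rewrite -(H j); congr (c _).
  by apply: val_inj; rewrite /= /bump leqNgt ltn_ord.
exists (fun j => - (c ord_max)^-1 * c (widen_ord (leqnSn n) j)).
rewrite -[LHS]scale1r -(mulVf cm) -scalerA cq scalerN -scaleNr scaler_sumr.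
by apply: eq_bigr => j _; rewrite scalerA.
Qed.

Variable g : R -> R.
Hypothesis g_Loo : g \in Lfun nu +oo%E.
Hypothesis g_neq0 : (0 < @lebesgue_measure R (I `&` [set x | g x != 0%R]))%E.

Lemma support_not_negligible : ~ nu.-negligible (I `&` [set x | g x != 0%R]).
Proof.
move=> [B [mB B0 EB]].
have mE : measurable (I `&` [set x | g x != 0%R] : set (measurableTypeR R)).
  apply: measurableI; first exact: measurable_Iset.
  have mg := Lfun_measurable g_Loo.
  have := mg measurableT (~` [set 0]) (measurableC (measurable_set1 0)).
  rewrite setTI (_ : _ @^-1` _ = [set x | g x != 0%R])//.
  by apply/seteqP; split=> x /= /eqP.
move: g_neq0; rewrite ltNge => /negP; apply.
rewrite -B0 /leb_I/= /mrestr le_measure ?inE//.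
  by apply: measurableI => //; exact: measurable_Iset.
by move=> x [Ix gx]; split=> //; apply: EB.
Qed.

Lemma Xcr_mulop_eq0 (q : V) : mulop g (span_val q) = 0 -> q = 0.
Proof.
move=> gq; apply: (Xcr_eq0 support_not_negligible).
apply: filterS2 (mulopE g_Loo (span_val q)) (L2_fun0 nu) => x; rewrite gq => -> /eqP + [_ /= gx].
by rewrite mulf_eq0 (negbTE gx) => /eqP.
Qed.

(** [S w] is sought in the span of the [g e i], where the conditions [<g S w, e k> = <w, e k>] form
    a linear system with the Gram matrix. The explicit formula serves to bound the feedback. *)
Lemma Bcr_right_inverse : exists S : {linear V -> X},
  (forall w, Bcr l eps1 alpha1 rho g (S w) = w) /\
  exists n (e : 'I_n -> V) (c : 'I_n -> 'I_n -> R) (h : 'I_n -> X),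
  forall w, S w = \sum_i (\sum_j L2_inner (span_val w) (span_val (e j)) * c j i) *: h i.
Proof.
have [n [e [ei es]]] := Xcr_basis.
pose h i := mulop g (span_val (e i)).
pose M : 'M[R]_n := \matrix_(i, j) L2_inner (h i) (h j).
have Mu : M \in unitmx.
  (* If [v M = 0], then [g q], the combination of the [h i] with coefficients [v], is orthogonal to
     every [h j], hence to itself. *)
  rewrite -row_free_unit -kermx_eq0; apply/eqP/eqP/rowV0P => v /sub_kermxP vM.
  pose q := \sum_i v 0 i *: e i.
  have hq : mulop g (span_val q) = \sum_i v 0 i *: h i.
    rewrite span_val_sum.
    elim/big_rec2: _ => [|i x y _ IH].
      by have := mulopZ g_Loo 0 (0 : X); rewrite !scale0r.
    by rewrite mulopD// mulopZ// IH.
  have q0 : q = 0.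
    apply: Xcr_mulop_eq0; apply: L2_inner_self_eq0; rewrite hq L2_inner_sumr.
    apply: big1 => j _; rewrite L2_innerZr L2_inner_suml.
    have := congr1 (fun N : 'rV_n => N 0 j) vM; rewrite !mxE => vMj.
    rewrite (_ : \sum_i _ = 0) ?mulr0// -[RHS]vMj.
    by apply: eq_bigr => i _; rewrite L2_innerZl mxE.
  by apply/rowP => i; rewrite mxE; exact: ei q0 i.
pose W (w : V) : 'rV[R]_n := \row_j L2_inner (span_val w) (span_val (e j)).
pose S0 (w : V) : X := \sum_i (W w *m invmx M) 0 i *: h i.
have S0l : linear S0.
  move=> a u v; rewrite /S0 scaler_sumr -big_split; apply: eq_bigr => i _ /=.
  have -> : W (a *: u + v) = a *: W u + W v.
    by apply/rowP => j; rewrite !mxE span_val_linear L2_innerDl L2_innerZl.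
  by rewrite mulmxDl -scalemxAl !mxE scalerDl scalerA.
pose S : {linear V -> X} := HB.pack S0 (GRing.isLinear.Build R V X *:%R S0 S0l).
exists S; split; last first.
  exists n, e, (fun j i => invmx M j i), h => w; rewrite /= /S0.
  apply: eq_bigr => i _; rewrite mxE; congr (_ *: _).
  by apply: eq_bigr => j _; rewrite mxE.
move=> w; apply: PcrE => y; have [c ->] := es y.
rewrite span_val_sum L2_inner_sumr; apply: big1 => k _.
rewrite (_ : span_val (c k *: e k) = c k *: span_val (e k))// L2_innerZr L2_innerBl.
(* Multiplication by [g] is symmetric, so [<g S w, e k>] becomes [<S w, h k>], a row of the Gram
   system. *)
rewrite mulop_sym// -/(h k) /= /S0 L2_inner_suml.
under eq_bigr do rewrite L2_innerZl.
have := congr1 (fun N : 'rV_n => N 0 k) (mulmxKV Mu (W w)).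
rewrite !mxE => E; rewrite (_ : \sum_i _ = L2_inner (span_val w) (span_val (e k))) ?subrr ?mulr0//.
by rewrite -E; apply: eq_bigr => i _; rewrite [M i k]mxE.
Qed.

End critical_space.

Theorem proposition3 (R : realType) (l eps1 rho : R) (alpha1 g : R -> R)
  (l_gt0 : 0 < l) (eps1_gt0 : 0 < eps1) (rho_gt0 : 0 < rho)
  (alpha1_Loo : alpha1 \in Lfun (leb_I l) +oo%E)
  (g_Loo : g \in Lfun (leb_I l) +oo%E)
  (g_neq0 : (0 < lebesgue_measure (Iset l `&` [set x | g x != 0%R]))%E) :
  controllable (Acr l eps1 alpha1 rho) (Bcr l eps1 alpha1 rho g) /\
  exists K : {linear Xcr l eps1 alpha1 rho -> L2 (leb_I l)},
    continuous K /\
    let AK := fun q => Acr l eps1 alpha1 rho q + Bcr l eps1 alpha1 rho g (K q) in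
    hurwitz AK /\
    exists M omega : R, [/\ 1 <= M, 0 < omega &
      forall t : R, 0 <= t ->
        (op_norm (exp_op AK t) <= (M * expR (- omega * t))%:E)%E].
Proof.
have [S [BS [n [e [c [h SE]]]]]] :=
  Bcr_right_inverse rho l_gt0 eps1_gt0 alpha1_Loo g_Loo g_neq0.
have Alin := @Acr_linear R l eps1 rho alpha1 l_gt0 alpha1_Loo.
pose V := Xcr l eps1 alpha1 rho.
pose A : {linear V -> V} :=
  HB.pack (Acr l eps1 alpha1 rho) (GRing.isLinear.Build R V V *:%R _ Alin).
split; first exact: (@controllable_right_inverse R V (L2 (leb_I l)) A _ S BS).
pose K0 (q : V) := S (- q - A q).
have K0l : linear K0.
  move=> a u v; rewrite /K0 -linearP; congr (S _).
  by have -> := linearP A a u v; rewrite scalerBr scalerN !opprD addrACA.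
pose K : {linear V -> L2 (leb_I l)} :=
  HB.pack K0 (GRing.isLinear.Build R V (L2 (leb_I l)) *:%R K0 K0l).
exists K; split.
  (* Symmetry of [An] moves it from [q] to the fixed vector [e j], so that Cauchy-Schwarz bounds
     [K q] by the norm of [q] alone. *)
  pose f j := - (span_val (e j) + An eps1 alpha1 (span_val (e j))).
  have KE q : K q = \sum_i (\sum_j L2_inner (span_val q) (f j) * c j i) *: h i.
    rewrite /= /K0 SE; apply: eq_bigr => i _; congr (_ *: _); apply: eq_bigr => j _.
    congr (_ * _); rewrite (_ : span_val (- q - A q) = - span_val q - span_val (A q))//.
    rewrite L2_innerBl L2_innerNl.
    rewrite /= AcrE// An_sym//; [|exact: Xcr_D|exact: Xcr_D].
    by rewrite /f [RHS]L2_innerNr (L2_innerDr _ (span_val (e j))) opprD.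
  pose C := \sum_i (\sum_j `|f j| * `|c j i|) * `|h i|.
  have KC q : `|K q| <= C * `|q|.
    rewrite KE /C mulr_suml; apply: le_trans (ler_norm_sum _ _ _) _.
    apply: ler_sum => i _; rewrite normrZ mulrAC ler_wpM2r// mulr_suml.
    apply: le_trans (ler_norm_sum _ _ _) _; apply: ler_sum => j _.
    rewrite normrM mulrAC ler_wpM2r//; apply: le_trans (L2_cauchy_schwarz _ _) _.
    by rewrite mulrC.
  exact: linear_continuous_of_bound KC.
have -> : (fun q => Acr l eps1 alpha1 rho q + Bcr l eps1 alpha1 rho g (K q)) = (fun q => - q).
  by apply/funext => q; rewrite /= /K0 BS addrC subrK.
split; first exact: hurwitz_opp.
exists 1, 1; split=> // t t0; apply: op_norm_le => v v1.
rewrite exp_op_opp normrZ ger0_norm ?expR_ge0// mul1r mulN1r.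
by rewrite ler_piMr ?expR_ge0.
Qed.
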